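(* $\mathcal{GM}(\Delta^3)\simeq\mathcal{GM}(\partial\Delta^3)\simeq\bigvee^{39}S^4$.
   Context: All simplicial complexes are finite abstract simplicial complexes; simplices are nonempty. $\Delta^3$ is the simplicial complex of all nonempty subsets of a $4$-element vertex set and $\partial\Delta^3$ its subcomplex of proper nonempty subsets. The Hasse diagram $\mathcal{H}(K)$ of $K$ is the directed graph whose vertices are the simplices of $K$, with an edge $\sigma\to\tau$ whenever $\sigma\subsetneq\tau$ and $\dim\tau=\dim\sigma+1$. A matching on $\mathcal{H}(K)$ is a set of edges of $\mathcal{H}(K)$, no two sharing a vertex. The generalized complex of discrete Morse matchings $\mathcal{GM}(K)$ is the simplicial complex whose vertices are the edges of $\mathcal{H}(K)$ and whose simplices are all nonempty matchings on $\mathcal{H}(K)$ (no acyclicity condition). *)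

(* Defs.v *)
From HB Require Import structures.
From mathcomp Require Import all_boot all_order all_algebra.
From mathcomp Require Import all_classical all_reals all_analysis.
Unset Printing Implicit Defensive.
Import Order.TTheory GRing.Theory Num.Theory.
Import numFieldNormedType.Exports.
Local Open Scope ring_scope.

Definition is_simplicial_complex (V : finType) (K : {set {set V}}) : bool :=
  (finset.set0 \notin K) &&
  [forall s in K, forall t : {set V}, (t != finset.set0) && (t \subset s) ==> (t \in K)].

Definition Delta3 : {set {set 'I_4}} := [set s : {set 'I_4} | s != finset.set0].
Definition bdDelta3 : {set {set 'I_4}} :=
  [set s : {set 'I_4} | (s != finset.set0) && (s != [set: 'I_4])].

Definition hasse_edge (V : finType) (K : {set {set V}}) (e : {set V} * {set V}) : bool :=
  [&& e.1 \in K, e.2 \in K, e.1 \proper e.2 & #|e.2| == #|e.1|.+1].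

Definition hasse_matching (V : finType) (K : {set {set V}})
    (M : {set {set V} * {set V}}) : bool :=
  [forall e in M, hasse_edge V K e] &&
  [forall e in M, forall f in M,
     (e != f) ==> [&& e.1 != f.1, e.1 != f.2, e.2 != f.1 & e.2 != f.2]].

(** The generalized complex of discrete Morse matchings GM(K):
    vertices = edges of H(K), simplices = nonempty matchings. *)
Definition GM (V : finType) (K : {set {set V}}) : {set {set {set V} * {set V}}} :=
  [set M | (M != finset.set0) && hasse_matching V K M].

(** Geometric realization |K| of a simplicial complex K on vertex type V,
    as a subspace of R^V (product = Euclidean topology, V finite):
    points with barycentric coordinates whose support is a simplex of K. *)
Definition realization (R : realType) (V : finType) (K : {set {set V}})
    : set {ptws V -> R} :=
  (fun x => (forall v, 0 <= x v) /\ (\sum_(v : V) x v = 1) /\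
           ([set v | x v != 0] \in K)).

(** Wedge of n copies of the d-sphere S^d, as a subspace of (R^(d+1))^n:
    each block lies on the unit sphere of R^(d+1), and all but at most one
    block equal the base point e_0 = (1,0,...,0). *)
Definition sphere_basept (R : realType) (d : nat) (j : 'I_d.+1) : R :=
  if nat_of_ord j == 0%N then 1 else 0.

Definition wedge_spheres (R : realType) (n d : nat)
    : set {ptws ('I_n * 'I_d.+1) -> R} :=
  (fun x => (forall i : 'I_n, \sum_(j < d.+1) (x (i, j)) ^+ 2 = 1) /\
           (forall i k : 'I_n, i != k ->
              (forall j, x (i, j) = sphere_basept R d j) \/
              (forall j, x (k, j) = sphere_basept R d j))).

Definition homotopic (R : realType) (X Y : topologicalType) (f g : X -> Y) : Prop :=
  exists H : (set_type (`[0, 1]%classic : set R)) * X -> Y,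
    continuous H /\
    (forall t x, set_val t = 0 -> H (t, x) = f x) /\
    (forall t x, set_val t = 1 -> H (t, x) = g x).

Definition homotopy_equivalent (R : realType) (X Y : topologicalType) : Prop :=
  exists (f : X -> Y) (g : Y -> X),
    [/\ continuous f, continuous g,
        homotopic R X X (g \o f) idfun & homotopic R Y Y (f \o g) idfun].

(* Main.v *)
Require Import Defs.
From HB Require Import structures.
From mathcomp Require Import all_boot all_order all_algebra.
From mathcomp Require Import all_classical all_reals all_analysis.
From mathcomp Require Import ring lra.
From Stdlib Require Import PArith.
Local Open Scope classical_set_scope.
Import Order.TTheory GRing.Theory Num.Theory.
Import numFieldNormedType.Exports.
Local Open Scope ring_scope.

(** If every simplex of a complex containing the face s can be enlarged by the
    vertex v, then pushing the common mass of the vertices of s onto v deforms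
    the complex onto the complex of simplices not containing s.  Such steps
    collapse GM(K), for K = Delta^3 and for its boundary, onto a 4-dimensional
    complex L having 39 facets whose removal leaves a collapsible complex A.
    Let L' be the union of L with a cone over A.  Collapsing A inside the cone
    shows that L' collapses to L as well.  Finally L' consists of a cone and 39
    facets attached to it along their boundaries; contracting the cone extends
    to a homotopy of L', and the quotient of L' by the cone is the wedge of the
    39 spheres that are the facets modulo their boundaries. *)

(** * Homotopy equivalence *)

Section Subspaces.

(** The detour through L' replaces a homotopy extension argument. A contraction of A is known only
    as a long list of collapses, and extending it explicitly over the 39 facets would be unwieldy. A
    cone contracts along straight segments, so on L' a single formula gives the whole homotopy,
    while the passage between L' and L is once more a list of collapses. No quotient space is
    formed: the wedge inside Euclidean space is the target of an explicit continuous surjection that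
    identifies exactly the points of the cone, and compactness makes this surjection a quotient map.
    Complexes are stored by nonfaces. GM(K) has far more simplices than minimal nonfaces, since
    being a matching is a condition on pairs of edges, and removing a face adds just one nonface.
    The number 39 does not depend on the collapses chosen: it is the reduced Euler
    characteristic. *)

Lemma continuous_o (X Y Z : topologicalType) (f : X -> Y) (g : Y -> Z) :
  continuous f -> continuous g -> continuous (fun x => g (f x)).
Proof. by move=> fc gc x; apply: continuous_comp; [exact: fc | exact: gc]. Qed.

Lemma continuous_pair (X Y Z : topologicalType) (f : X -> Y) (g : X -> Z) :
  continuous f -> continuous g -> continuous (fun x => (f x, g x)).
Proof. by move=> fc gc x; apply: cvg_pair; [exact: fc | exact: gc]. Qed.

Lemma continuous_fst (X Y : topologicalType) : continuous (@fst X Y).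
Proof. by move=> z; exact: cvg_fst. Qed.

Lemma continuous_snd (X Y : topologicalType) : continuous (@snd X Y).
Proof. by move=> z; exact: cvg_snd. Qed.

Lemma ptws_continuous (R : realType) (V : finType) (Z : topologicalType)
    (h : Z -> {ptws V -> R}) :
  (forall v, continuous (fun z => h z v)) -> continuous h.
Proof.
move=> hc z; apply/(@cvg_sup (V -> R) V (fun v => Topological.class
  (initial_topology (fun f : V -> R => f v))) (h @ z) (h z)) => v.
exact: (@continuous_comp_initial _ _ _ (fun f : V -> R => f v) h (hc v)).
Qed.

Lemma ptws_proj_continuous (R : realType) (V : finType) (v : V) :
  continuous (fun x : {ptws V -> R} => x v).
Proof. exact: (@proj_continuous V (fun=> R) v). Qed.

Lemma set_val_continuous (X : topologicalType) (A : set X) :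
  continuous (set_val : set_type A -> X).
Proof. exact: initial_continuous. Qed.

Lemma set_type_continuous (X Z : topologicalType) (A : set X)
    (f : Z -> set_type A) : continuous (set_val \o f) -> continuous f.
Proof. exact: continuous_comp_initial. Qed.

Definition codom_restr (X : topologicalType) (Z : Type) (A : set X)
    (f : Z -> X) (fA : forall z, A (f z)) (z : Z) : set_type A :=
  exist _ (f z) (mem_set (fA z)).

Lemma codom_restr_continuous (X Z : topologicalType) (A : set X) (f : Z -> X)
    (fA : forall z, A (f z)) : continuous f -> continuous (codom_restr X Z A f fA).
Proof. by move=> fc; apply: set_type_continuous. Qed.

Lemma bigmin_continuous (R : realType) (Z : topologicalType) (I : Type)
    (r : seq I) (P : pred I) (b : R) (F : I -> Z -> R) :
  (forall i, continuous (F i)) ->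
  continuous (fun z => \big[Num.min/b]_(i <- r | P i) F i z).
Proof.
move=> Fc; elim: r => [|i r IH].
  under eq_fun do rewrite big_nil; exact: cst_continuous.
under eq_fun do rewrite big_cons; case: (P i) => // z.
exact: (@continuous_min _ _ (F i) (fun z => \big[Num.min/b]_(i <- r | P i) F i z)
  z (Fc i z) (IH z)).
Qed.

Lemma sum_continuous (R : realType) (Z : topologicalType) (I : Type)
    (r : seq I) (P : pred I) (F : I -> Z -> R) :
  (forall i, continuous (F i)) ->
  continuous (fun z => \sum_(i <- r | P i) F i z).
Proof.
move=> Fc; elim: r => [|i r IH].
  under eq_fun do rewrite big_nil; exact: cst_continuous.
under eq_fun do rewrite big_cons; case: (P i) => // z.
exact: cvgD (Fc i z) (IH z).
Qed.

Lemma prod_continuous (R : realType) (Z : topologicalType) (I : Type)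
    (r : seq I) (P : pred I) (F : I -> Z -> R) :
  (forall i, continuous (F i)) ->
  continuous (fun z => \prod_(i <- r | P i) F i z).
Proof.
move=> Fc; elim: r => [|i r IH].
  under eq_fun do rewrite big_nil; exact: cst_continuous.
under eq_fun do rewrite big_cons; case: (P i) => // z.
exact: cvgM (Fc i z) (IH z).
Qed.

End Subspaces.

Section HomotopyEquivalence.
Variable R : realType.
Local Notation I01 := (set_type (`[0, 1]%classic : set R)).

Lemma I01P (t : I01) : 0 <= set_val t <= 1.
Proof. by have := set_valP t; rewrite /= in_itv. Qed.

(** Clamping makes times such as [2 * t] and [2 * t - 1] points of the unit interval for every real
    [t], so both halves of a concatenated homotopy are total and continuous before they are
    glued. *)
Definition clamp01 (r : R) : R := Num.max 0 (Num.min 1 r).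

Lemma clamp01_in (r : R) : (`[0, 1]%classic : set R) (clamp01 r).
Proof.
by rewrite /clamp01 /= in_itv /= le_max lexx /= ge_max ler01 ge_min lexx.
Qed.

Definition to_I01 : R -> I01 := codom_restr _ _ _ clamp01 clamp01_in.

Lemma to_I01_id (r : R) : 0 <= r <= 1 -> set_val (to_I01 r) = r.
Proof.
case/andP=> r0 r1; rewrite -[LHS]/(Num.max 0 (Num.min 1 r)).
by rewrite min_r // max_r.
Qed.

Lemma to_I01_continuous : continuous to_I01.
Proof.
apply: codom_restr_continuous => r; rewrite /clamp01.
apply: (@continuous_max _ _ (fun=> 0) (fun r : R => Num.min 1 r)).
  exact: cvg_cst.
apply: (@continuous_min _ _ (fun=> 1) id); [exact: cvg_cst | exact: cvg_id].
Qed.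

Lemma I01_fst_continuous (X : topologicalType) :
  continuous (fun z : I01 * X => set_val z.1).
Proof.
exact: continuous_o (@continuous_fst I01 X) (set_val_continuous _ _).
Qed.

Lemma homotopic_const (X Y : topologicalType) (f g : X -> Y) :
  continuous f -> f =1 g -> homotopic R X Y f g.
Proof.
move=> fc fg; exists (fun z => f z.2); split; last by split => // t x _; rewrite fg.
exact: continuous_o (@continuous_snd I01 X) fc.
Qed.

Lemma reparam_continuous (X Y : topologicalType) (H : I01 * X -> Y)
    (a : I01 * X -> R) :
  continuous H -> continuous a -> continuous (fun z => H (to_I01 (a z), z.2)).
Proof.
move=> Hc ac; apply: continuous_o Hc; apply: continuous_pair.
  exact: continuous_o ac to_I01_continuous.
exact: continuous_snd.
Qed.

Lemma homotopic_sym (X Y : topologicalType) (f g : X -> Y) :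
  homotopic R X Y f g -> homotopic R X Y g f.
Proof.
move=> [H [Hc [H0 H1]]].
exists (fun z => H (to_I01 (1 - set_val z.1), z.2)); split; [|split].
- apply: (reparam_continuous _ _ H (fun z => 1 - set_val z.1)) => // z.
  apply: cvgB; [exact: cvg_cst | exact: I01_fst_continuous].
- by move=> t x t0; rewrite H1 // to_I01_id /= t0; lra.
- by move=> t x t1; rewrite H0 // to_I01_id /= t1; lra.
Qed.

Lemma homotopic_trans (X Y : topologicalType) (f g h : X -> Y) :
  homotopic R X Y f g -> homotopic R X Y g h -> homotopic R X Y f h.
Proof.
move=> [F [Fc [F0 F1]]] [G [Gc [G0 G1]]].
pose F' (z : I01 * X) := F (to_I01 (2 * set_val z.1), z.2).
pose G' (z : I01 * X) := G (to_I01 (2 * set_val z.1 - 1), z.2).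
have t2c : continuous (fun z : I01 * X => 2 * set_val z.1).
  by move=> z; apply: cvgM; [exact: cvg_cst | exact: I01_fst_continuous].
have F'c : continuous F' by exact: reparam_continuous.
have G'c : continuous G'.
  apply: (reparam_continuous _ _ G (fun z => 2 * set_val z.1 - 1)) => // z.
  by apply: cvgB; [exact: t2c | exact: cvg_cst].
pose H (z : I01 * X) := if 2 * set_val z.1 <= 1 then F' z else G' z.
exists H; split; [|split].
(* Pasting along two closed sets: they overlap only at time 1/2, where both halves equal [g]. *)
- pose A := [set z : I01 * X | 2 * set_val z.1 <= 1].
  pose B := [set z : I01 * X | 1 <= 2 * set_val z.1].
  have cA : closed A by exact: (continuous_closedP _).1 t2c _ (@closed_le R 1).
  have cB : closed B by exact: (continuous_closedP _).1 t2c _ (@closed_ge R 1).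
  have AB : A `|` B = setT.
    by rewrite -subTset => z _; have [?|/ltW ?] := leP (2 * set_val z.1) 1; [left|right].
  apply/continuous_subspace_setT; rewrite -AB; apply: withinU_continuous => //.
    apply: (subspace_eq_continuous (f := F')); last exact: continuous_subspaceT.
    by move=> z /set_mem zA; rewrite /from_subspace /H; case: ifP => //; rewrite zA.
  apply: (subspace_eq_continuous (f := G')); last exact: continuous_subspaceT.
  move=> z /set_mem z1; rewrite /from_subspace /H; case: ifP => // z1'.
  have zE : 2 * set_val z.1 = 1 by apply/le_anti/andP.
  by rewrite /F' /G' F1 ?G0 // to_I01_id zE ?lexx ?ler01 // subrr ?lexx ?ler01.
- by move=> t x t0; rewrite /H /F' /= t0 mulr0 ler01 F0 // to_I01_id; lra.
- move=> t x t1; rewrite /H ifF; last by rewrite /= t1; lra.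
  by rewrite /G' G1 // to_I01_id /= t1; lra.
Qed.

Lemma homotopic_compl (X Y Z : topologicalType) (f g : X -> Y) (k : Y -> Z) :
  continuous k -> homotopic R X Y f g -> homotopic R X Z (k \o f) (k \o g).
Proof.
move=> kc [H [Hc [H0 H1]]]; exists (k \o H); split; [|split].
- exact: continuous_o Hc kc.
- by move=> t x t0 /=; rewrite H0.
- by move=> t x t1 /=; rewrite H1.
Qed.

Lemma homotopic_compr (X Y Z : topologicalType) (f g : X -> Y) (k : Z -> X) :
  continuous k -> homotopic R X Y f g -> homotopic R Z Y (f \o k) (g \o k).
Proof.
move=> kc [H [Hc [H0 H1]]].
exists (fun z => H (z.1, k z.2)); split; [|split].
- apply: continuous_o Hc; apply: continuous_pair; first exact: continuous_fst.
  exact: continuous_o (@continuous_snd I01 Z) kc.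
- by move=> t x t0 /=; rewrite H0.
- by move=> t x t1 /=; rewrite H1.
Qed.

Lemma homotopy_equivalent_sym (X Y : topologicalType) :
  homotopy_equivalent R X Y -> homotopy_equivalent R Y X.
Proof. by move=> [f [g [? ? ? ?]]]; exists g, f. Qed.

Lemma homotopy_equivalent_trans (X Y Z : topologicalType) :
  homotopy_equivalent R X Y -> homotopy_equivalent R Y Z ->
  homotopy_equivalent R X Z.
Proof.
move=> [f [g [fc gc gf fg]]] [f' [g' [f'c g'c gf' fg']]].
exists (f' \o f), (g \o g'); split.
- by move=> x; apply: continuous_comp; [exact: fc | exact: f'c].
- by move=> x; apply: continuous_comp; [exact: g'c | exact: gc].
- apply: homotopic_trans gf.
  exact: (homotopic_compl _ _ _ _ _ g gc (homotopic_compr _ _ _ _ _ f fc gf')).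
- apply: homotopic_trans fg'.
  exact: (homotopic_compl _ _ _ _ _ f' f'c (homotopic_compr _ _ _ _ _ g' g'c fg)).
Qed.

Lemma homotopy_equivalent_refl (X : topologicalType) : homotopy_equivalent R X X.
Proof.
have idc : continuous (@idfun X) by move=> x; exact: cvg_id.
by exists idfun, idfun; split => //; exact: homotopic_const.
Qed.

End HomotopyEquivalence.

(** * Quotient maps from compact spaces *)

Section Quotient.

Lemma compact_set_type (X : topologicalType) (A : set X) :
  compact A -> compact [set: set_type A].
Proof.
move=> Ac F PF _.
have [|x [Ax Fx]] := Ac (set_val @ F) (fmap_proper_filter set_val PF).
  have FA : set_val @^-1` A = [set: set_type A].
    by apply/seteqP; split => // x _; exact: set_valP.
  by rewrite /fmap /= FA; exact: filterT.
exists (exist _ x (mem_set Ax)); split => // B C FB [D [[E oE <-] /= xE] DC].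
have [] := Fx (set_val @` B) E.
- by apply: (@filterS _ F _ B) => // y By; exists y.
- exact: open_nbhs_nbhs.
- by move=> _ [[y By <-] Ey]; exists y; split => //; exact: DC.
Qed.

Lemma injective_hausdorff (X Y : topologicalType) (f : X -> Y) :
  continuous f -> injective f -> hausdorff_space Y -> hausdorff_space X.
Proof.
move=> fc fi hY p q pq; apply/fi/hY => A B /fc An /fc Bn.
by have [z [Az Bz]] := pq _ _ An Bn; exists (f z).
Qed.

Lemma prod_hausdorff (X Y : topologicalType) :
  hausdorff_space X -> hausdorff_space Y -> hausdorff_space (X * Y)%type.
Proof.
move=> hX hY [p p'] [q q'] pq; congr pair.
- apply: hX => A B An Bn.
  have [||z [? ?]] := pq (fst @^-1` A) (fst @^-1` B); last by exists z.1.
  + exact: (@cvg_fst _ _ _ _ _ _ An).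
  + exact: (@cvg_fst _ _ _ _ _ _ Bn).
- apply: hY => A B An Bn.
  have [||z [? ?]] := pq (snd @^-1` A) (snd @^-1` B); last by exists z.2.
  + exact: (@cvg_snd _ _ _ _ _ _ An).
  + exact: (@cvg_snd _ _ _ _ _ _ Bn).
Qed.

(** A continuous map from a compact space to a Hausdorff space is closed, so the surjection [q] is a
    quotient map. The factor is built from a section [s] of [q] and is continuous although [s] need
    not be. *)
Lemma quotient_factor (X Y Z : topologicalType) (q : X -> Z) (h : X -> Y) :
  compact [set: X] -> hausdorff_space Z -> continuous q ->
  (forall z, exists x, q x = z) -> continuous h ->
  (forall x x', q x = q x' -> h x = h x') ->
  exists2 g : Z -> Y, continuous g & forall x, g (q x) = h x.
Proof.
move=> Xc Zh qc qs hc hq.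
have [s sK] := choice qs.
exists (h \o s); last by move=> x /=; apply: hq; rewrite sK.
apply/continuous_closedP => W Wcl.
have -> : (h \o s) @^-1` W = q @` (h @^-1` W).
  apply/seteqP; split => [z /= Wz|_ [x Wx <-] /=]; first by exists (s z).
  by rewrite (hq (s (q x)) x) // sK.
apply: compact_closed => //; apply: continuous_compact.
  exact: continuous_subspaceT.
apply: (subclosed_compact _ Xc) => //.
exact: (continuous_closedP _).1.
Qed.

End Quotient.

(** * Dominated faces *)

Section Realization.
Variables (R : realType) (V : finType).
Implicit Types (x : {ptws V -> R}) (s t : {set V}) (K : {set {set V}}).

Definition supp x : {set V} := [set v | x v != 0]%SET.

Lemma in_supp x v : (v \in supp x) = (x v != 0).
Proof. by rewrite inE. Qed.

Lemma notin_supp x v : v \notin supp x -> x v = 0.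
Proof. by rewrite in_supp negbK => /eqP. Qed.

Lemma complex_down K s t : is_simplicial_complex V K ->
  s \in K -> t != finset.set0 -> t \subset s -> t \in K.
Proof.
move=> /andP[_ /forall_inP H] sK t0 ts.
by have /forallP/(_ t) := H s sK; rewrite t0 ts.
Qed.

Lemma realization_intro K x s : is_simplicial_complex V K ->
  (forall v, 0 <= x v) -> \sum_v x v = 1 -> s \in K -> supp x \subset s ->
  realization R V K x.
Proof.
move=> Kc x0 x1 sK xs; split=> //; split => //.
apply: complex_down sK _ xs => //; apply/negP => /eqP s0.
have : \sum_v x v = 0.
  by apply: big1 => v _; apply: notin_supp; rewrite s0 inE.
by rewrite x1 => /eqP; rewrite oner_eq0.
Qed.

Lemma realization_ge0 K x v : realization R V K x -> 0 <= x v.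
Proof. by case. Qed.

Lemma realization_sum K x : realization R V K x -> \sum_v x v = 1.
Proof. by case=> _ []. Qed.

Lemma realization_supp K x : realization R V K x -> supp x \in K.
Proof. by case=> _ []. Qed.

Lemma realization_le1 K x v : realization R V K x -> x v <= 1.
Proof.
move=> Kx; rewrite -(realization_sum _ _ Kx) (bigD1 v) //= lerDl.
by apply: sumr_ge0 => w _; exact: realization_ge0 Kx.
Qed.

(* The default 1 bounds every coordinate, so this is the minimum for nonempty [s]. *)
Definition minc s x : R := \big[Num.min/1]_(u in s) x u.

Lemma minc_ge0 K s x : realization R V K x -> 0 <= minc s x.
Proof.
by move=> Kx; apply: le_bigmin => // v _; exact: realization_ge0 Kx.
Qed.

Lemma minc_le s x u : u \in s -> minc s x <= x u.
Proof. by move=> us; exact: bigmin_le_cond. Qed.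

Lemma minc_attained K s x : realization R V K x -> s != finset.set0 ->
  exists2 u, u \in s & minc s x = x u.
Proof.
move=> Kx /finset.set0Pn[u0 u0s].
exists [arg min_(u < u0 | u \in s) x u]%O; case: arg_minP => // u us umin.
apply/le_anti; rewrite minc_le //=.
by apply: le_bigmin => //; exact: realization_le1 Kx.
Qed.

Lemma minc_gt0 K s x : realization R V K x -> s != finset.set0 ->
  (0 < minc s x) = (s \subset supp x).
Proof.
move=> Kx s0; apply/idP/fintype.subsetP => [m0 u us|sx].
  by rewrite in_supp gt_eqF // (lt_le_trans m0) // minc_le.
have [u us ->] := minc_attained K s x Kx s0.
by rewrite lt_neqAle (realization_ge0 K) // andbT eq_sym -in_supp sx.
Qed.

Lemma minc_eq0 K s x : realization R V K x -> s != finset.set0 ->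
  ~~ (s \subset supp x) -> minc s x = 0.
Proof.
move=> Kx s0; rewrite -(minc_gt0 K) // -leNgt => m0.
by apply/le_anti; rewrite m0 (minc_ge0 K).
Qed.

Lemma minc_continuous s : continuous (minc s).
Proof. by apply: bigmin_continuous => u; exact: ptws_proj_continuous. Qed.

(* Closedness: [supp x] lies in [K] iff every monomial over a nonface vanishes
   at [x]. *)
Lemma realization_compact K :
  is_simplicial_complex V K -> compact (realization R V K).
Proof.
move=> Kc.
have cube : compact [set x : {ptws V -> R} | forall v, x v \in `[0, 1]].
  exact: (@tychonoff V (fun=> R) (fun=> `[0, 1]%classic)
    (fun=> @segment_compact R 0 1)).
apply: subclosed_compact cube _; last first.
  by move=> x Kx v; rewrite in_itv /= (realization_ge0 K) ?(realization_le1 K).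
have pc v := @ptws_proj_continuous R V v.
have -> : realization R V K =
    (\bigcap_(v in [set: V]) [set x : {ptws V -> R} | 0 <= x v]) `&`
    ([set x : {ptws V -> R} | \sum_v x v = 1] `&`
    \bigcap_(s in [set s : {set V} | s \notin K /\ s != finset.set0])
      [set x : {ptws V -> R} | \prod_(v in s) x v = 0]).
  apply/seteqP; split => [x Kx|x [x0 [x1 xK]]].
    split; first by move=> v _; exact: realization_ge0 Kx.
    split; first exact: realization_sum Kx.
    move=> s [sK s0] /=; apply/eqP; apply: contraNT sK => p0.
    apply: complex_down (realization_supp _ _ Kx) s0 _ => //.
    apply/fintype.subsetP => v vs; rewrite in_supp.
    by apply: contraNneq p0 => v0; rewrite (bigD1 v) //= v0 mul0r.
  split; first by move=> v; exact: x0.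
  split => //; apply: contraT => nK.
  have /= /eqP : \prod_(v in supp x) x v = 0.
    apply: xK; split => //; apply/negP => /eqP s0.
    have : \sum_v x v = 0.
      by apply: big1 => v _; apply: notin_supp; rewrite s0 inE.
    by rewrite x1 => /eqP; rewrite oner_eq0.
  by move=> /prodf_eq0[v]; rewrite in_supp => /negP.
have cl (f : {ptws V -> R} -> R) (D : set R) :
    continuous f -> closed D -> closed (f @^-1` D).
  by move=> fc; exact: (continuous_closedP _).1 fc D.
apply: closedI; last apply: closedI; [|exact: cl (sum_continuous _ _ _ _ _ _ pc) (@closed_eq R 1)|].
- by apply: closed_bigI => v _; exact: cl (pc v) (@closed_ge R 0).
- apply: closed_bigI => s _.
  exact: cl (prod_continuous _ _ _ _ _ _ pc) (@closed_eq R 0).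
Qed.

Lemma realization_ptws_hausdorff : hausdorff_space {ptws V -> R}.
Proof. by apply: hausdorff_product => v; exact: Rhausdorff. Qed.

End Realization.

Section Collapse.
Variables (R : realType) (V : finType) (K : {set {set V}}) (s : {set V}) (v : V).
Hypotheses (Kc : is_simplicial_complex V K) (s0 : s != finset.set0)
  (vs : v \notin s)
  (dom : forall t, t \in K -> s \subset t -> (v |: t)%SET \in K).

Let K' : {set {set V}} := [set t in K | ~~ (s \subset t)]%SET.

(* Moves the common mass [minc s x] of the vertices of [s] onto [v]. *)
Definition collapse_map (a : R) (x : {ptws V -> R}) : {ptws V -> R} :=
  fun w => x w + a * (minc R V s x * (#|s|%:R * (w == v)%:R - (w \in s)%:R)).

Lemma collapse_map_id (a : R) (x : {ptws V -> R}) :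
  a * minc R V s x = 0 -> collapse_map a x = x.
Proof.
by move=> am0; apply/funext => w; rewrite /collapse_map mulrA am0 mul0r addr0.
Qed.

(** What [v] gains is what the vertices of [s] lose together. *)
Lemma collapse_map_sum (a : R) (x : {ptws V -> R}) :
  \sum_w collapse_map a x w = \sum_w x w.
Proof.
have e0 : \sum_w (#|s|%:R * (w == v)%:R - (w \in s)%:R) = 0 :> R.
  rewrite sumrB -mulr_sumr (bigD1 v) //= eqxx big1 => [|w /negbTE -> //].
  by rewrite -natr_sum -big_mkcond /= sum1_card addr0 mulr1 subrr.
by rewrite big_split /= -mulr_sumr -mulr_sumr e0 !mulr0 addr0.
Qed.

Lemma collapse_map_ge0 (a : R) (x : {ptws V -> R}) w : 0 <= a <= 1 ->
  realization R V K x -> 0 <= collapse_map a x w.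
Proof.
move=> /andP[a0 a1] Kx; rewrite /collapse_map.
have m0 := minc_ge0 R V K s x Kx.
have x0 := realization_ge0 R V K x w Kx.
have am : a * minc R V s x <= minc R V s x by rewrite ler_piMl.
case: (boolP (w \in s)) => ws /=.
  have -> : (w == v) = false by apply: contraTF ws => /eqP ->.
  by have := minc_le R V s x w ws; rewrite mulr0 sub0r mulrN1 mulrN; lra.
by rewrite subr0 addr_ge0 // !mulr_ge0.
Qed.

(** Either [s] lies in the support of [x] and domination provides the simplex [v |: supp x], or the
    minimum over [s] is 0 and nothing moves. *)
Lemma collapse_map_supp (a : R) (x : {ptws V -> R}) :
  realization R V K x ->
  exists2 t, t \in K & supp R V (collapse_map a x) \subset t /\ supp R V x \subset t.
Proof.
move=> Kx; have [sx|nsx] := boolP (s \subset supp R V x); last first.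
  exists (supp R V x); first exact: realization_supp Kx.
  by rewrite collapse_map_id // (minc_eq0 R V K) ?mulr0.
exists (v |: supp R V x)%SET; first exact/dom/sx/realization_supp.
split; last exact: finset.subsetUr.
apply/fintype.subsetP => w; rewrite in_setU1 !in_supp /collapse_map.
apply: contraNT; rewrite negb_or negbK => /andP[/negbTE wv /eqP xw].
rewrite xw wv mulr0 sub0r add0r.
have -> : (w \in s) = false.
  by apply/negP => /(fintype.subsetP sx); rewrite in_supp xw eqxx.
by rewrite oppr0 !mulr0.
Qed.

Lemma collapse_map_realization (a : R) (x : {ptws V -> R}) :
  0 <= a <= 1 -> realization R V K x -> realization R V K (collapse_map a x).
Proof.
move=> a01 Kx; have [t tK [st _]] := collapse_map_supp a x Kx.
apply: realization_intro st => //.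
- by move=> w; exact: collapse_map_ge0.
- by rewrite collapse_map_sum (realization_sum R V K).
Qed.

(** A vertex of [s] that realises the minimum loses all its mass, so [s] is no longer inside the
    support. *)
Lemma collapse_map1 (x : {ptws V -> R}) :
  realization R V K x -> realization R V K' (collapse_map 1 x).
Proof.
move=> Kx; have a01 : 0 <= (1 : R) <= 1 by rewrite ler01 lexx.
have [? [? xK]] := collapse_map_realization 1 x a01 Kx.
split => //; split => //; rewrite inE xK /=.
have [u us mu] := minc_attained R V K s x Kx s0.
apply/negP => /fintype.subsetP/(_ u us); rewrite in_supp /collapse_map mu us.
have -> : (u == v) = false by apply: contraTF us => /eqP ->.
by rewrite mulr0 sub0r mul1r mulrN1 subrr eqxx.
Qed.

Lemma collapse_map_continuous (Z : topologicalType) (a : Z -> R)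
    (f : Z -> {ptws V -> R}) : continuous a -> continuous f ->
  continuous (fun z => collapse_map (a z) (f z)).
Proof.
move=> ac fc; apply: ptws_continuous => w z; apply: cvgD.
  exact: (continuous_o _ _ _ f (fun y : {ptws V -> R} => y w) fc
    (ptws_proj_continuous R V w) z).
apply: cvgM; first exact: ac.
apply: cvgM; last exact: cvg_cst.
exact: (continuous_o _ _ _ f _ fc (minc_continuous R V s) z).
Qed.

(** A strong deformation retraction: the minimum over [s] vanishes on [K'], so points of [K'] never
    move. Time is reversed because the homotopy has to end at the identity. *)
Lemma collapse_homotopy_equivalent :
  homotopy_equivalent R (set_type (realization R V K)) (set_type (realization R V K')).
Proof.
have vKx (x : set_type (realization R V K)) : realization R V K (set_val x).
  exact: set_valP.
have K'K (x : set_type (realization R V K')) : realization R V K (set_val x).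
  by case: (set_valP x) => ? [? ]; rewrite inE => /andP[? _]; split.
pose f := codom_restr _ _ _ (fun x : set_type (realization R V K) =>
  collapse_map 1 (set_val x)) (fun x => collapse_map1 _ (vKx x)).
pose g := codom_restr _ _ _ (fun x : set_type (realization R V K') => set_val x) K'K.
have HK (z : set_type (`[0, 1]%classic : set R) * set_type (realization R V K)) :
    realization R V K (collapse_map (1 - set_val z.1) (set_val z.2)).
  apply: collapse_map_realization => //.
  by have := I01P R z.1; lra.
exists f, g; split.
- apply: codom_restr_continuous; apply: (collapse_map_continuous _ (fun=> 1)).
    exact: cst_continuous.
  exact: set_val_continuous.
- by apply: codom_restr_continuous; exact: set_val_continuous.
- exists (codom_restr _ _ _ _ HK); split; [|split].
  + apply: codom_restr_continuous; apply: collapse_map_continuous.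
      by move=> z; apply: cvgB; [exact: cvg_cst | exact: I01_fst_continuous].
    exact: continuous_o (@continuous_snd _ _) (set_val_continuous _ _).
  + by move=> t x t0; apply: val_inj; rewrite /= t0 subr0.
  + move=> t x t1; apply: val_inj.
    by rewrite /= collapse_map_id // t1 subrr mul0r.
- have fg : f \o g =1 idfun.
    move=> x; apply: val_inj => /=; rewrite collapse_map_id // mul1r.
    apply: (minc_eq0 R V K) => //.
    by have [_ [_]] := set_valP x; rewrite inE => /andP[].
  have -> : f \o g = idfun by apply/funext.
  by apply: homotopic_const => // x; exact: cvg_id.
Qed.

End Collapse.

(** * A cone with facets attached *)

Section ConeAndFacets.
Variables (R : realType) (V : finType) (n d : nat).
Variables (L : {set {set V}}) (c : V) (u : 'I_n -> 'I_d.+1 -> V).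

Definition facet (i : 'I_n) : {set V} := [set u i j | j : 'I_d.+1]%SET.

Hypotheses (Lc : is_simplicial_complex V L) (u_inj : forall i, injective (u i))
  (facet_in : forall i, facet i \in L) (facet_inj : injective facet)
  (facet_max : forall i s, s \in L -> facet i \subset s -> s = facet i)
  (cone : forall s, s \in L -> (forall i, ~~ (facet i \subset s)) -> (c |: s)%SET \in L)
  (cL : [set c]%SET \in L) (cF : forall i, c \notin facet i).

Local Notation D := (d.+1%:R : R).
Local Notation X := (realization R V L).
Local Notation m i x := (minc R V (facet i) x).

Lemma D_gt0 : 0 < D. Proof. exact: ltr0Sn. Qed.

Lemma facet_neq0 i : facet i != finset.set0.
Proof. by apply/finset.set0Pn; exists (u i ord0); apply: imset_f. Qed.

Lemma card_facet i : #|facet i| = d.+1.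
Proof. by rewrite card_imset ?card_ord. Qed.

Lemma in_facet i j : u i j \in facet i.
Proof. exact: imset_f. Qed.

Lemma sum_facet i (f : V -> R) : \sum_(w in facet i) f w = \sum_j f (u i j).
Proof. by rewrite big_imset //= => j k _ _; exact: u_inj. Qed.

Lemma sum_facet_ind i : \sum_w (w \in facet i)%:R = D.
Proof. by rewrite -natr_sum -big_mkcond /= sum1_card card_facet. Qed.

(** By maximality a support that contains [facet i] equals it, and distinct indices give distinct
    facets. So the open facets are disjoint cells, and the points where all minima vanish form the
    cone. *)
Lemma flat_or_open_cell (x : {ptws V -> R}) : X x ->
  (forall i, m i x = 0) \/
  exists i, [/\ 0 < m i x, supp R V x = facet i & forall k, k != i -> m k x = 0].
Proof.
move=> Xx; have [[i mi]|H] := pselect (exists i, 0 < m i x); last first.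
  left => i; apply/le_anti; rewrite (minc_ge0 R V L) // andbT leNgt.
  by apply/negP => mi; apply: H; exists i.
right; exists i; have sx := realization_supp _ _ _ _ Xx.
have Si : supp R V x = facet i.
  by apply: facet_max => //; rewrite -(minc_gt0 R V L) ?facet_neq0.
split => // k ki; apply: (minc_eq0 R V L) => //; first exact: facet_neq0.
apply: contra ki => /(facet_max _ _ sx) Sk.
by apply/eqP/facet_inj; rewrite -Sk.
Qed.

(** * The contraction of the cone *)

Lemma sum_e_c : \sum_w (w == c)%:R = 1 :> R.
Proof. by rewrite (bigD1 c) //= eqxx big1 ?addr0 // => w /negbTE ->. Qed.

Lemma e_c_realization : X (fun w => (w == c)%:R).
Proof.
apply: realization_intro cL _ => //.
- exact: sum_e_c.
- by apply/fintype.subsetP => w; rewrite in_supp finset.in_set1; case: (w == c); rewrite ?eqxx.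
Qed.

Lemma flat_e_c i : m i (fun w => (w == c)%:R) = 0.
Proof.
apply: (minc_eq0 R V L); [exact: e_c_realization | exact: facet_neq0 |].
apply/fintype.subsetPn; exists (u i ord0); first exact: in_facet.
rewrite in_supp negbK; have /negbTE -> : u i ord0 != c; last by rewrite eqxx.
by apply: contraTneq (cF i) => <-; rewrite negbK in_facet.
Qed.

(** The mass of the barycentric component. At most one summand is nonzero at a point of [X]; summing
    over all facets gives one formula for the cone and every cell, so continuity needs no gluing. *)
Definition flat_sum (x : {ptws V -> R}) : R := \sum_i D * m i x.

(* An unnormalised homotopy from the identity that pushes the cone to its apex:
   in a facet, the barycentric component shrinks and the component in the
   boundary of the facet is moved towards the apex once the former vanishes. *)
Definition push_num (t : R) (x : {ptws V -> R}) (w : V) : R :=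
  Num.min 1 (1 - t + flat_sum x) * (x w - \sum_i m i x * (w \in facet i)%:R)
  + \sum_i Num.max 0 (m i x - t / (2 * D)) * (w \in facet i)%:R
  + Num.max 0 (t - 2 * flat_sum x) * (w == c)%:R.

Definition push (t : R) (x : {ptws V -> R}) : {ptws V -> R} :=
  fun w => push_num t x w / \sum_v push_num t x v.

Lemma flat_sum_flat x : (forall i, m i x = 0) -> flat_sum x = 0.
Proof. by move=> x0; apply: big1 => i _; rewrite x0 mulr0. Qed.

Lemma flat_sum_cell x i : (forall k, k != i -> m k x = 0) ->
  flat_sum x = D * m i x.
Proof.
move=> x0; rewrite /flat_sum (bigD1 i) //= big1 ?addr0 // => k ki.
by rewrite x0 ?mulr0.
Qed.

Lemma push_num_flat t x w : 0 <= t <= 1 -> (forall i, m i x = 0) ->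
  push_num t x w = (1 - t) * x w + t * (w == c)%:R.
Proof.
move=> /andP[t0 t1] x0; rewrite /push_num flat_sum_flat //.
rewrite addr0 mulr0 subr0 [Num.min _ _]min_r; last lra.
rewrite [Num.max _ t]max_r // big1 => [|i _]; last by rewrite x0 mul0r.
rewrite subr0 big1 ?addr0 // => i _.
by rewrite x0 sub0r [Num.max _ _]max_l ?mul0r // oppr_le0 divr_ge0 // mulr_ge0.
Qed.

Lemma push_num_cell t x w i : 0 <= t -> (forall k, k != i -> m k x = 0) ->
  push_num t x w =
  Num.min 1 (1 - t + D * m i x) * (x w - m i x * (w \in facet i)%:R)
  + Num.max 0 (m i x - t / (2 * D)) * (w \in facet i)%:R
  + Num.max 0 (t - 2 * (D * m i x)) * (w == c)%:R.
Proof.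
move=> t0 x0; rewrite /push_num (flat_sum_cell _ _ x0).
congr (_ * (_ - _) + _ + _); rewrite (bigD1 i) //= big1 ?addr0 // => k ki.
  by rewrite x0 ?mul0r.
by rewrite x0 // sub0r [Num.max _ _]max_l ?mul0r // oppr_le0 divr_ge0 // mulr_ge0.
Qed.

Lemma cell_le1 x i : X x -> D * m i x <= 1.
Proof.
move=> Xx; suff : D * m i x <= \sum_w x w by rewrite (realization_sum _ _ _ _ Xx).
rewrite -(sum_facet_ind i) mulr_suml.
apply: ler_sum => w _; case: (boolP (w \in facet i)) => wi.
  by rewrite mul1r; exact: minc_le.
by rewrite mul0r; exact: realization_ge0 Xx.
Qed.

Lemma cell_sub_ge0 x w i : X x -> 0 <= x w - m i x * (w \in facet i)%:R.
Proof.
move=> Xx; case: (boolP (w \in facet i)) => wi.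
  by rewrite mulr1 subr_ge0; exact: minc_le.
by rewrite mulr0 subr0; exact: realization_ge0 Xx.
Qed.

Lemma push_num_ge0 t x w : 0 <= t <= 1 -> X x -> 0 <= push_num t x w.
Proof.
move=> /[dup] t01 /andP[t0 t1] Xx.
have max0 (a : R) : 0 <= Num.max 0 a by rewrite le_max lexx.
have [x0|[i [mi _ x0]]] := flat_or_open_cell x Xx.
  rewrite push_num_flat // addr_ge0 // mulr_ge0 ?ler0n ?subr_ge0 //.
  exact: realization_ge0 Xx.
rewrite (push_num_cell t x w i) //.
have Dm : 0 < D * m i x by rewrite mulr_gt0 // D_gt0.
rewrite !addr_ge0 // mulr_ge0 ?cell_sub_ge0 // le_min ler01 /=; lra.
Qed.

Lemma push_den_gt0 t x : 0 <= t <= 1 -> X x -> 0 < \sum_w push_num t x w.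
Proof.
move=> /[dup] t01 /andP[t0 t1] Xx.
have max0 (a : R) : 0 <= Num.max 0 a by rewrite le_max lexx.
have [x0|[i [mi _ x0]]] := flat_or_open_cell x Xx.
  under eq_bigr do rewrite push_num_flat //.
  rewrite big_split /= -!mulr_sumr (realization_sum _ _ _ _ Xx) sum_e_c; lra.
under eq_bigr do rewrite (push_num_cell t x _ i) //.
rewrite !big_split /= -!mulr_sumr sumrB -mulr_sumr sum_facet_ind sum_e_c mulr1.
rewrite (realization_sum _ _ _ _ Xx) (mulrC (m i x)).
have Dm : 0 < D * m i x by rewrite mulr_gt0 // D_gt0.
apply: ltr_wpDr => //.
have : D * m i x <= 1 by exact: cell_le1.
(* At the barycentre the boundary component vanishes and the barycentric one keeps mass [1 - t / 2].
   Elsewhere in the cell the boundary component has positive mass, and its factor is positive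
   because [D * m i x] is. *)
rewrite le_eqVlt => /orP[/eqP Dm1|Dm1].
  apply: ltr_wpDl; first by rewrite Dm1 subrr mulr0.
  rewrite mulr_gt0 ?D_gt0 // lt_max; apply/orP; right.
  rewrite -(ltr_pM2l D_gt0) mulr0 mulrBr Dm1 invfM mulrCA (mulrCA D).
  rewrite mulfV ?gt_eqF ?D_gt0 //; lra.
apply: ltr_wpDr; first by rewrite mulr_ge0.
by rewrite mulr_gt0 ?subr_gt0 // lt_min ltr01 /=; lra.
Qed.

(** The thresholds are matched: in a cell the barycentric term is nonzero only for
    [t < 2 * D * m i x], the apex term only for [t > 2 * D * m i x]. They must never occur together,
    because a facet joined with [c] is not a simplex. *)
Lemma push_num_supp t x : 0 <= t <= 1 -> X x ->
  exists2 s, s \in L & forall w, w \notin s -> push_num t x w = 0.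
Proof.
move=> /[dup] t01 /andP[t0 t1] Xx; have sx := realization_supp _ _ _ _ Xx.
have [x0|[i [mi Si x0]]] := flat_or_open_cell x Xx.
  exists (c |: supp R V x)%SET.
    apply: cone => // i; apply/negP; rewrite -(minc_gt0 R V L) ?facet_neq0 //.
    by rewrite x0 ltxx.
  move=> w; rewrite finset.in_setU1 negb_or => /andP[/negbTE wc /notin_supp xw].
  by rewrite push_num_flat // xw wc !mulr0 addr0.
have [mt|mt] := ltP (t / (2 * D)) (m i x).
  exists (facet i) => // w wi; rewrite (push_num_cell t x w i) // (negbTE wi).
  have -> : x w = 0 by apply: notin_supp; rewrite Si.
  rewrite mulr0 subrr !mulr0 !add0r [Num.max _ _]max_l ?mul0r //.
  move: mt; rewrite ltr_pdivrMr ?mulr_gt0 ?D_gt0 // => mt.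
  by rewrite subr_le0 ltW // mulrA mulrC.
(* The barycentric term is gone, so a vertex [a] of least mass carries nothing. The rest of the
   facet contains no facet and can therefore be joined with [c]. *)
have [a ai ma] := minc_attained R V L (facet i) x Xx (facet_neq0 i).
exists (c |: (facet i :\ a))%SET.
  (* For [d = 0] only the apex is left. *)
  have [->|fa0] := eqVneq (facet i :\ a)%SET finset.set0; first by rewrite finset.setU0.
  have faL : (facet i :\ a)%SET \in L.
    exact: complex_down Lc (facet_in i) fa0 (finset.subD1set _ _).
  apply: cone => // k; apply/negP => ka.
  have ki : facet i = facet k.
    by apply: facet_max => //; exact: fintype.subset_trans ka (finset.subD1set _ _).
  by move: ka => /fintype.subsetP/(_ a); rewrite -ki ai !inE eqxx => /(_ isT).
move=> w; rewrite finset.in_setU1 finset.in_setD1 negb_or negb_and negbK => /andP[/negbTE wc wa].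
rewrite (push_num_cell t x w i) // wc mulr0 addr0 [Num.max _ _]max_l; last by rewrite subr_le0.
rewrite mul0r addr0; case/orP: wa => [/eqP ->|wi].
  by rewrite ai mulr1 ma subrr mulr0.
have -> : x w = 0 by apply: notin_supp; rewrite Si.
by rewrite (negbTE wi) mulr0 subrr mulr0.
Qed.

Lemma push_realization t x : 0 <= t <= 1 -> X x -> X (push t x).
Proof.
move=> t01 Xx; have [s sL sP] := push_num_supp t x t01 Xx.
have T0 := push_den_gt0 t x t01 Xx.
apply: realization_intro sL _ => //.
- by move=> w; rewrite divr_ge0 ?(ltW T0) // push_num_ge0.
- by rewrite -mulr_suml mulfV // gt_eqF.
- apply/fintype.subsetP => w; rewrite in_supp; apply: contraNT => ws.
  by rewrite /push sP // mul0r.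
Qed.

Lemma push_flat t x : 0 <= t <= 1 -> X x -> (forall i, m i x = 0) ->
  push t x = fun w => (1 - t) * x w + t * (w == c)%:R.
Proof.
move=> t01 Xx x0; apply/funext => w; rewrite /push push_num_flat //.
under [X in _ / X]eq_bigr do rewrite push_num_flat //.
rewrite big_split /= -!mulr_sumr (realization_sum _ _ _ _ Xx) sum_e_c.
by rewrite !mulr1 subrK divr1.
Qed.

(** A vertex of a facet that is missing from the support stays missing, since it is not [c]. As the
    cone is thus kept inside itself, the homotopy descends to the quotient at every time. *)
Lemma push_flat_flat t x : 0 <= t <= 1 -> X x -> (forall i, m i x = 0) ->
  forall i, m i (push t x) = 0.
Proof.
move=> t01 Xx x0 i; apply: (minc_eq0 R V L); [exact: push_realization|exact: facet_neq0|].
have : ~~ (facet i \subset supp R V x).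
  by rewrite -(minc_gt0 R V L) ?facet_neq0 // x0 ltxx.
move=> /fintype.subsetPn[w wi wx]; apply/fintype.subsetPn; exists w => //.
rewrite in_supp negbK push_flat // (notin_supp _ _ _ _ wx).
have -> : (w == c) = false by apply/negP => /eqP wc; move: (cF i); rewrite -wc wi.
by rewrite !mulr0 addr0.
Qed.

Lemma push0 x : X x -> push 0 x = x.
Proof.
move=> Xx; have m0 i : 0 <= m i x by exact: minc_ge0 Xx.
have S0 : 0 <= flat_sum x by apply: sumr_ge0 => i _; rewrite mulr_ge0.
have px w : push_num 0 x w = x w.
  rewrite /push_num subr0 [Num.min _ _]min_l; last lra.
  rewrite [Num.max _ (0 - _)]max_l; last lra.
  rewrite !mul0r addr0 mul1r; under [X in _ + X]eq_bigr => i _.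
    rewrite subr0 [Num.max _ _]max_r //; over.
  by rewrite subrK.
apply/funext => w; rewrite /push px; under eq_bigr do rewrite px.
by rewrite (realization_sum _ _ _ _ Xx) divr1.
Qed.

Lemma push1_flat x : X x -> (forall i, m i x = 0) ->
  push 1 x = fun w => (w == c)%:R.
Proof.
move=> Xx x0; rewrite push_flat ?ler01 ?lexx //.
by apply/funext => w; rewrite subrr mul0r add0r mul1r.
Qed.

Lemma push_continuous (Z : topologicalType) (t : Z -> R) (f : Z -> {ptws V -> R}) :
  continuous t -> continuous f -> (forall z, 0 <= t z <= 1) -> (forall z, X (f z)) ->
  continuous (fun z => push (t z) (f z)).
Proof.
move=> tc fc t01 Xf.
have fwc w : continuous (fun z => f z w).
  exact: continuous_o fc (ptws_proj_continuous R V w).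
have mc i : continuous (fun z => m i (f z)).
  exact: continuous_o fc (minc_continuous R V (facet i)).
have sc : continuous (fun z => flat_sum (f z)).
  by apply: sum_continuous => i z; apply: cvgM; [exact: cvg_cst | exact: mc].
have nc w : continuous (fun z => push_num (t z) (f z) w).
  move=> z; apply: cvgD; first apply: cvgD.
  - apply: cvgM.
      apply: (@continuous_min _ _ (fun=> 1) (fun z => 1 - t z + flat_sum (f z))).
        exact: cvg_cst.
      by apply: cvgD; [apply: cvgB; [exact: cvg_cst | exact: tc] | exact: sc].
    apply: cvgB; first exact: fwc.
    apply: (sum_continuous R Z _ _ _ (fun i z => m i (f z) * (w \in facet i)%:R)).
    by move=> i y; apply: cvgM; [exact: mc | exact: cvg_cst].
  - apply: (sum_continuous R Z _ _ _ (fun i z =>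
      Num.max 0 (m i (f z) - t z / (2 * D)) * (w \in facet i)%:R)) => i y.
    apply: cvgM; last exact: cvg_cst.
    apply: (@continuous_max _ _ (fun=> 0) (fun z => m i (f z) - t z / (2 * D))).
      exact: cvg_cst.
    by apply: cvgB; [exact: mc | apply: cvgM; [exact: tc | exact: cvg_cst]].
  - apply: cvgM; last exact: cvg_cst.
    apply: (@continuous_max _ _ (fun=> 0) (fun z => t z - 2 * flat_sum (f z))).
      exact: cvg_cst.
    by apply: cvgB; [exact: tc | apply: cvgM; [exact: cvg_cst | exact: sc]].
apply: ptws_continuous => w z; apply: cvgM; first exact: nc.
apply: cvgV; first by rewrite gt_eqF // push_den_gt0.
exact: (sum_continuous R Z _ _ _ (fun v z => push_num (t z) (f z) v)).
Qed.

(** * The quotient map onto the wedge of spheres *)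

Definition offset (i : 'I_n) (x : {ptws V -> R}) (j : 'I_d.+1) : R :=
  x (u i j) - x (u i ord0).

Definition offset2 i x : R := \sum_j offset i x j ^+ 2.

Definition outside i (x : {ptws V -> R}) : R := 1 - \sum_j x (u i j).

Definition stereo_den i x : R := offset2 i x + (D * m i x) ^+ 2 + outside i x.

(* On the open cell of [facet i] this is the inverse of the stereographic
   projection applied to [offset i x / (D * m i x)]; everything else is sent to
   the base point.  The term [outside i x] only keeps the denominator from
   vanishing off the facet. *)
Definition stereo (x : {ptws V -> R}) : {ptws ('I_n * 'I_d.+1) -> R} :=
  fun ij => if nat_of_ord ij.2 == 0%N
    then (offset2 ij.1 x + outside ij.1 x - (D * m ij.1 x) ^+ 2) / stereo_den ij.1 x
    else 2 * (D * m ij.1 x) * offset ij.1 x ij.2 / stereo_den ij.1 x.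

Lemma offset2_ge0 i x : 0 <= offset2 i x.
Proof. by apply: sumr_ge0 => j _; exact: sqr_ge0. Qed.

Lemma outside_ge0 i x : X x -> 0 <= outside i x.
Proof.
move=> Xx; rewrite subr_ge0 -sum_facet -(realization_sum _ _ _ _ Xx) big_mkcond /=.
by apply: ler_sum => w _; case: ifP => // _; exact: realization_ge0 Xx.
Qed.

Lemma outside_cell i x : X x -> 0 < m i x -> outside i x = 0.
Proof.
move=> Xx; rewrite (minc_gt0 R V L) ?facet_neq0 // => fx.
have Si := facet_max _ _ (realization_supp _ _ _ _ Xx) fx.
rewrite /outside -sum_facet -(realization_sum _ _ _ _ Xx) [X in _ - X]big_mkcond /=.
apply/eqP; rewrite subr_eq0; apply/eqP/eq_bigr => w _; case: ifPn => //.
by rewrite -Si => /notin_supp.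
Qed.

(** If all three nonnegative terms vanished, the coordinates on the facet would all equal their
    minimum 0, and the mass outside the facet would be 1 instead of 0. *)
Lemma stereo_den_gt0 i x : X x -> 0 < stereo_den i x.
Proof.
move=> Xx; have o0 := outside_ge0 i x Xx; have y0 := offset2_ge0 i x.
have s0 := sqr_ge0 (D * m i x).
rewrite lt_neqAle (addr_ge0 (addr_ge0 y0 s0) o0) andbT eq_sym /stereo_den.
apply/negP; rewrite (paddr_eq0 (addr_ge0 y0 s0) o0) (paddr_eq0 y0 s0) => /andP[/andP[]].
rewrite psumr_eq0 => [/allP yz|j _]; last exact: sqr_ge0.
rewrite sqrf_eq0 mulf_eq0 gt_eqF ?D_gt0 //= => /eqP m0 /eqP out0.
have xc j : x (u i j) = x (u i ord0).
  have := yz j; rewrite mem_index_enum => /(_ isT).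
  by rewrite /= sqrf_eq0 subr_eq0 => /eqP.
have [w wi] := minc_attained R V L (facet i) x Xx (facet_neq0 i).
move: wi => /imsetP[j _ ->]; rewrite m0 xc => x0.
move: out0; rewrite /outside big1 => [/eqP|k _]; last by rewrite xc -x0.
by rewrite subr0 oner_eq0.
Qed.

(** With minimum 0, the numerator of entry 0 coincides with the denominator and the other numerators
    vanish. *)
Lemma stereo_base i x : X x -> m i x = 0 ->
  forall j, stereo x (i, j) = sphere_basept R d j.
Proof.
move=> Xx m0 j; have := stereo_den_gt0 i x Xx.
rewrite /stereo /sphere_basept /stereo_den /= m0 mulr0 expr0n /= subr0 addr0 => den0.
by case: ifP => _; [rewrite mulfV // gt_eqF | rewrite !mulr0 !mul0r].
Qed.

Lemma stereo_cell i x : X x -> 0 < m i x ->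
  1 - stereo x (i, ord0) = 2 * (D * m i x) ^+ 2 / stereo_den i x.
Proof.
move=> Xx mi; have := stereo_den_gt0 i x Xx.
rewrite /stereo /= /stereo_den outside_cell // !addr0.
by move: (D * _) (offset2 i x) => s y den0; field; rewrite gt_eqF.
Qed.

Lemma stereo_cell_lt1 i x : X x -> 0 < m i x -> 0 < 1 - stereo x (i, ord0).
Proof.
move=> Xx mi; rewrite stereo_cell // divr_gt0 ?stereo_den_gt0 //.
by rewrite mulr_gt0 // exprn_gt0 // mulr_gt0 // D_gt0.
Qed.

Lemma stereo_cell_offset i x j : X x -> 0 < m i x ->
  offset i x j = D * m i x *
    (if nat_of_ord j == 0%N then 0 else stereo x (i, j) / (1 - stereo x (i, ord0))).
Proof.
move=> Xx mi; have den0 := stereo_den_gt0 i x Xx.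
case: ifPn => [/eqP j0|j0].
  have -> : j = ord0 by apply: val_inj.
  by rewrite mulr0 /offset subrr.
rewrite stereo_cell // {1}/stereo /= (negbTE j0).
have := mulr_gt0 D_gt0 mi; move: (stereo_den i x) den0 (D * _) => e e0 s s0.
by field; rewrite !gt_eqF.
Qed.

Lemma stereo_wedge x : X x -> wedge_spheres R n d (stereo x).
Proof.
move=> Xx; split=> [i|i k ik].
  have [m0|mi] : m i x = 0 \/ 0 < m i x.
    by have := minc_ge0 R V L (facet i) x Xx; rewrite le_eqVlt => /orP[/eqP <-|]; [left|right].
    rewrite (bigD1 ord0) //= big1 => [|j j0]; rewrite stereo_base // /sphere_basept /=.
      by rewrite expr1n addr0.
    by rewrite ifF ?expr0n //; apply/negP => /eqP jz; case/eqP: j0; exact: val_inj.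
  have den0 := stereo_den_gt0 i x Xx.
  have y0 : offset i x ord0 = 0 by rewrite /offset subrr.
  have yE : offset2 i x = \sum_(j < d.+1 | j != ord0) offset i x j ^+ 2.
    by rewrite /offset2 (bigD1 ord0) //= y0 expr0n add0r.
  rewrite (bigD1 ord0) //= {1}/stereo /=.
  under eq_bigr => j j0.
    rewrite /stereo /= ifF; last first.
      by apply/negP => /eqP jz; case/eqP: j0; exact: val_inj.
    rewrite mulrAC exprMn; over.
  rewrite -mulr_sumr -yE; move: den0; rewrite /stereo_den outside_cell // !addr0.
  by move: (D * _) (offset2 i x) => s y den0'; field; rewrite gt_eqF.
have [x0|[l [_ _ x0]]] := flat_or_open_cell x Xx.
  by left; apply: stereo_base.
have [il|il] := eqVneq i l; last by left; apply: stereo_base => //; exact: x0.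
by right; apply: stereo_base => //; apply: x0; rewrite -il eq_sym.
Qed.

(** Stereographic projection from the pole recovers [z], the offsets divided by the scale
    [s = D * m i x]. Offsets determine the coordinates up to a common constant, which is fixed by
    the least coordinate, at [a], being [m i x = s / D]. *)
Lemma stereo_cell_coord i x : X x -> 0 < m i x ->
  exists a, (forall j, let z k := if nat_of_ord k == 0%N then 0
      else stereo x (i, k) / (1 - stereo x (i, ord0)) in
    z a <= z j /\ x (u i j) = D * m i x * (D^-1 + z j - z a)).
Proof.
move=> Xx mi.
have [w wi] := minc_attained R V L (facet i) x Xx (facet_neq0 i).
move: wi => /imsetP[a _ ->] ma; exists a => j /=.
have Dm : 0 < D * m i x by rewrite mulr_gt0 // D_gt0.
have := stereo_cell_offset i x j Xx mi; have := stereo_cell_offset i x a Xx mi.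
move: (if _ then _ else _) (if _ then _ else _) => zj za ya yj.
have xj : x (u i j) = D * m i x * (D^-1 + zj - za).
  have -> : D * m i x * (D^-1 + zj - za) = m i x + D * m i x * zj - D * m i x * za.
    by rewrite mulrBr mulrDr [D * _ / D]mulrAC mulfV ?mul1r // gt_eqF // D_gt0.
  by rewrite -ya -yj ma /offset; ring.
split => //; rewrite -subr_ge0 -(pmulr_rge0 _ Dm).
have -> : D * m i x * (zj - za) = x (u i j) - x (u i a).
  by rewrite mulrBr -ya -yj /offset; ring.
by rewrite subr_ge0 -ma; exact/minc_le/in_facet.
Qed.

Lemma stereo_cell_inj i x x' : X x -> X x' -> 0 < m i x -> 0 < m i x' ->
  stereo x = stereo x' -> x = x'.
Proof.
move=> Xx Xx' mi mi' E.
have [a ax] := stereo_cell_coord i x Xx mi.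
have [a' ax'] := stereo_cell_coord i x' Xx' mi'.
move: ax ax'; rewrite E /=.
set z := fun k : 'I_d.+1 => if nat_of_ord k == 0%N then 0
  else stereo x' (i, k) / (1 - stereo x' (i, ord0)).
move=> ax ax'.
have zaa : z a = z a'.
  by apply/le_anti/andP; split; [exact: (ax a').1 | exact: (ax' a).1].
(* The last unknown, the scale, is determined by the total mass 1. *)
have sE (y : {ptws V -> R}) s : X y -> 0 < m i y ->
    (forall j, y (u i j) = s * (D^-1 + z j - z a)) ->
    s * \sum_j (D^-1 + z j - z a) = 1.
  move=> Xy my ys; rewrite mulr_sumr; under eq_bigr do rewrite -ys.
  by apply/esym/eqP; rewrite -subr_eq0; apply/eqP/outside_cell.
have E1 := sE x _ Xx mi (fun j => (ax j).2).
have E2 : D * m i x' * \sum_j (D^-1 + z j - z a) = 1.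
  by apply: (sE x') => // j; rewrite zaa; exact: (ax' j).2.
have s0 : \sum_j (D^-1 + z j - z a) != 0.
  by apply/eqP => s0; move: E1; rewrite s0 mulr0 => /esym/eqP; rewrite oner_eq0.
have mm : D * m i x = D * m i x' by apply: (mulIf s0); rewrite E1 E2.
have Sx (y : {ptws V -> R}) : X y -> 0 < m i y -> supp R V y = facet i.
  move=> Xy my; apply: facet_max; first exact: realization_supp Xy.
  by rewrite -(minc_gt0 R V L) ?facet_neq0.
apply/funext => w; have [/imsetP[j _ ->]|wi] := boolP (w \in facet i).
  by rewrite (ax j).2 (ax' j).2 -/(z a') -/(z j) -/(z a) mm zaa.
by rewrite !(notin_supp R V) // Sx.
Qed.

(** Entry 0 of block [i] is below 1 on the open cell of [facet i] and equals 1 off it, so the image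
    tells in which cell a point lies or that it lies in the cone. Only points of the cone are
    identified. *)
Lemma stereo_fibers x x' : X x -> X x' -> stereo x = stereo x' ->
  x = x' \/ (forall i, m i x = 0) /\ (forall i, m i x' = 0).
Proof.
have bp : sphere_basept R d ord0 = 1 by [].
have half y y' i : X y -> X y' -> stereo y = stereo y' -> 0 < m i y -> 0 < m i y'.
  move=> Xy Xy' E my; have := minc_ge0 R V L (facet i) y' Xy'.
  rewrite le_eqVlt => /orP[/eqP m0|//].
  have := stereo_cell_lt1 i y Xy my; rewrite E (stereo_base i y') // bp subrr.
  by rewrite ltxx.
move=> Xx Xx' E; have [x0|[i [mi _ _]]] := flat_or_open_cell x Xx; last first.
  by left; apply: (stereo_cell_inj i) => //; exact: half E mi.
right; split => // i; apply/le_anti; rewrite (minc_ge0 R V L) // andbT leNgt.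
by apply/negP => /(half x' x i Xx' Xx (esym E)); rewrite x0 ltxx.
Qed.

Lemma stereo_surj p : wedge_spheres R n d p -> exists2 x, X x & stereo x = p.
Proof.
move=> [psph pbase].
have bp : sphere_basept R d ord0 = 1 by [].
have base i : p (i, ord0) = 1 -> forall j, p (i, j) = sphere_basept R d j.
  move=> p0 j; have := psph i; rewrite (bigD1 ord0) //= p0 expr1n => /eqP.
  rewrite -subr_eq0 addrAC subrr add0r psumr_eq0 => [/allP s0|k _]; last exact: sqr_ge0.
  rewrite /sphere_basept; case: ifPn => [/eqP j0|j0].
    by have -> : j = ord0 by apply: val_inj.
  have := s0 j; rewrite mem_index_enum => /(_ isT); rewrite sqrf_eq0.
  by rewrite (_ : j != ord0) => [/eqP //|]; apply: contra j0 => /eqP ->.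
have [[i pi]|H] := pselect (exists i, p (i, ord0) <> 1); last first.
  exists (fun w => (w == c)%:R); first exact: e_c_realization.
  apply/funext => -[i j].
  have pi : p (i, ord0) = 1 by apply: contrapT => pi; apply: H; exists i.
  rewrite (base i pi); apply: (stereo_base i _ _ (flat_e_c i)).
  exact: e_c_realization.
have p1 : 0 < 1 - p (i, ord0).
  rewrite subr_gt0 lt_neqAle; apply/andP; split; first exact/eqP.
  rewrite (le_trans (ler_norm _)) // -(ler_pXn2r (n := 2)) ?nnegrE //.
  rewrite expr1n real_normK ?num_real // -(psph i) (bigD1 ord0) //= lerDl.
  by apply: sumr_ge0 => j _; exact: sqr_ge0.
(* Inverting the cell formula: [z] is the stereographic projection of block [i], the coordinates
   have to be proportional to [D^-1 + z j - z a], and dividing by the total [T] makes the scale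
   [D * m i x] equal to [T^-1]. *)
pose z j := if nat_of_ord j == 0%N then 0 else p (i, j) / (1 - p (i, ord0)).
pose a := [arg min_(k < ord0) z k]%O.
have za j : z a <= z j by rewrite /a; case: arg_minP => // k _; exact.
pose rho j := D^-1 + z j - z a.
have D0 := D_gt0.
have rho0 j : D^-1 <= rho j by rewrite /rho -addrA lerDl subr_ge0.
have rho_gt0 j : 0 < rho j by apply: lt_le_trans (rho0 j); rewrite invr_gt0.
pose T := \sum_j rho j.
have T0 : 0 < T.
  rewrite /T (bigD1 ord0) //= ltr_wpDr // sumr_ge0 // => j _; exact: ltW.
pose x : {ptws V -> R} := fun w => \sum_j rho j / T * (w == u i j)%:R.
have xu j : x (u i j) = rho j / T.
  rewrite /x (bigD1 j) //= eqxx mulr1 big1 ?addr0 // => k kj.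
  by rewrite (inj_eq (u_inj i)) eq_sym (negbTE kj) mulr0.
have xo w : w \notin facet i -> x w = 0.
  move=> wi; apply: big1 => j _; case: eqP => [wE|]; last by rewrite mulr0.
  by move: wi; rewrite wE in_facet.
have Xx : X x.
  apply: realization_intro (facet_in i) _ => //.
  - move=> w; apply: sumr_ge0 => j _; rewrite mulr_ge0 // divr_ge0 //; exact: ltW.
  - rewrite exchange_big /=; under eq_bigr => j _.
      rewrite -mulr_sumr (bigD1 (u i j)) //= eqxx big1 ?addr0 ?mulr1; last by move=> w /negbTE ->.
      over.
    by rewrite -mulr_suml mulfV // gt_eqF.
  - by apply/fintype.subsetP => w; rewrite in_supp; apply: contraR => /xo ->.
have xa : x (u i a) = (D * T)^-1.
  by rewrite xu /rho addrK invfM.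
have mx : m i x = (D * T)^-1.
  apply/le_anti; rewrite -xa minc_le ?in_facet //=.
  have [w /imsetP[j _ ->] ->] := minc_attained R V L (facet i) x Xx (facet_neq0 i).
  by rewrite xa xu invfM ler_pM2r ?invr_gt0.
have mi : 0 < m i x by rewrite mx invr_gt0 mulr_gt0.
have Dm : D * m i x = T^-1 by rewrite mx invfM mulrA mulfV ?mul1r // gt_eqF.
have yj j : offset i x j = T^-1 * z j.
  rewrite /offset !xu /rho {3}/z /= [X in _ - X / T](_ : _ = D^-1 - z a); last by ring.
  by rewrite -mulrBl mulrC; congr (_ * _); ring.
have z2 : \sum_j z j ^+ 2 = (1 + p (i, ord0)) / (1 - p (i, ord0)).
  rewrite (bigD1 ord0) //= {1}/z /= expr0n add0r.
  under eq_bigr => j j0.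
    rewrite /z ifF; last by apply/negP => /eqP jz; case/eqP: j0; exact: val_inj.
    rewrite exprMn; over.
  have := psph i; rewrite (bigD1 ord0) //= => /eqP; rewrite -subr_eq0 => /eqP pE.
  rewrite -mulr_suml (_ : \sum_(j < d.+1 | j != ord0) p (i, j) ^+ 2 = 1 - p (i, ord0) ^+ 2).
    by field; rewrite gt_eqF.
  by move: pE; move: (\sum_(_ < _ | _) _) => S pE; lra.
have o2 : offset2 i x = T^-1 ^+ 2 * ((1 + p (i, ord0)) / (1 - p (i, ord0))).
  rewrite /offset2; under eq_bigr do rewrite yj exprMn.
  by rewrite -mulr_sumr z2.
have den : stereo_den i x = 2 * T^-1 ^+ 2 / (1 - p (i, ord0)).
  rewrite /stereo_den outside_cell // o2 Dm; field.
  by rewrite !gt_eqF.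
exists x => //; apply/funext => -[k j].
have [->{k}|ki] := eqVneq k i; last first.
  rewrite stereo_base //.
    have [kb|ib] := pbase k i ki; first by rewrite kb.
    by case: pi; rewrite ib.
  have [x0|[l [ml _ x0]]] := flat_or_open_cell x Xx; first exact: x0.
  have [kl|kl] := eqVneq k l; last exact: x0.
  by move: mi; rewrite x0 ?ltxx // -kl eq_sym.
rewrite /stereo /=; case: ifPn => [/eqP j0|j0].
  have -> : j = ord0 by apply: val_inj.
  rewrite den o2 outside_cell // Dm; field.
  by rewrite !gt_eqF.
rewrite den Dm yj /z (negbTE j0); field.
by rewrite !gt_eqF.
Qed.

Lemma stereo_continuous (Z : topologicalType) (f : Z -> {ptws V -> R}) :
  continuous f -> (forall z, X (f z)) -> continuous (fun z => stereo (f z)).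
Proof.
move=> fc Xf.
have fwc w : continuous (fun z => f z w).
  exact: continuous_o fc (ptws_proj_continuous R V w).
have sc i : continuous (fun z => D * m i (f z)).
  move=> z; apply: cvgM; first exact: cvg_cst.
  exact: (continuous_o _ _ _ f _ fc (minc_continuous R V (facet i)) z).
have yc i j : continuous (fun z => offset i (f z) j).
  by move=> z; apply: cvgB; exact: fwc.
have y2c i : continuous (fun z => offset2 i (f z)).
  by apply: (sum_continuous R Z _ _ _ (fun j z => offset i (f z) j ^+ 2)) => j z;
    apply: cvgM; exact: yc.
have oc i : continuous (fun z => outside i (f z)).
  move=> z; apply: cvgB; first exact: cvg_cst.
  exact: (sum_continuous R Z _ _ _ (fun j z => f z (u i j)) (fun j => fwc (u i j)) z).
have s2c i : continuous (fun z => (D * m i (f z)) ^+ 2).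
  by move=> z; apply: cvgM; exact: sc.
have dc i : continuous (fun z => (stereo_den i (f z))^-1).
  move=> z; apply: cvgV; first by rewrite gt_eqF // stereo_den_gt0.
  exact: cvgD (cvgD (y2c i z) (s2c i z)) (oc i z).
apply: ptws_continuous => -[i j]; rewrite /stereo /=; case: (nat_of_ord j == 0%N) => z.
  apply: cvgM; last exact: dc.
  by apply: cvgB; [apply: cvgD; [exact: y2c | exact: oc] | exact: s2c].
apply: cvgM; last exact: dc.
apply: cvgM; last exact: yc.
by apply: cvgM; [exact: cvg_cst | exact: sc].
Qed.

(** The classical argument for collapsing a contractible subspace whose contraction extends to [X].
    The end of the homotopy [h] is constant on the cone, so it factors through [q] as [g]; as [h]
    preserves the cone, [q \o h] descends to a homotopy [G] of the wedge. Both run from an identity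
    to a composite of [q] and [g]. *)
Lemma wedge_homotopy_equivalent :
  homotopy_equivalent R (set_type X) (set_type (wedge_spheres R n d)).
Proof.
have vX (x : set_type X) : X (set_val x) by exact: set_valP.
pose I01 := set_type (`[0, 1]%classic : set R).
pose q := codom_restr _ _ _ (fun x : set_type X => stereo (set_val x))
  (fun x => stereo_wedge _ (vX x)).
have pX (z : I01 * set_type X) : X (push (set_val z.1) (set_val z.2)).
  by apply: push_realization => //; exact: I01P.
pose h := codom_restr _ _ _ _ pX.
have vc : continuous (fun x : set_type X => set_val x) by exact: set_val_continuous.
have qc : continuous q by apply: codom_restr_continuous; exact: stereo_continuous.
have hc : continuous h.
  apply: codom_restr_continuous; apply: push_continuous.
  - exact: I01_fst_continuous.
  - exact: continuous_o (@continuous_snd I01 (set_type X)) vc.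
  - by move=> z; exact: I01P.
  - by move=> z.
have qE x x' : q x = q x' -> x = x' \/
    (forall i, m i (set_val x) = 0) /\ (forall i, m i (set_val x') = 0).
  move=> /(congr1 set_val) /= E.
  by have [/val_inj|] := stereo_fibers _ _ (vX x) (vX x') E; [left|right].
have qs w : exists x, q x = w.
  have [x Xx xw] := stereo_surj _ (set_valP w).
  by exists (exist _ x (mem_set Xx)); apply: val_inj.
have Xcpt : compact [set: set_type X] by exact/compact_set_type/realization_compact.
have Icpt : compact [set: I01] by exact/compact_set_type/segment_compact.
have Whaus : hausdorff_space (set_type (wedge_spheres R n d)).
  apply: (injective_hausdorff _ _ set_val); first exact: set_val_continuous.
    exact: val_inj.
  exact: realization_ptws_hausdorff.
have Ihaus : hausdorff_space I01.
  apply: (injective_hausdorff _ _ set_val); first exact: set_val_continuous.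
    exact: val_inj.
  exact: Rhausdorff.
pose one := to_I01 R 1.
have one1 : set_val one = 1 by rewrite to_I01_id // ler01 lexx.
have h1c : continuous (fun x => h (one, x)).
  apply: (continuous_o _ _ _ (fun x => (one, x)) h) => //.
  by apply: continuous_pair; [exact: cst_continuous | move=> x; exact: cvg_id].
have [g gc gq] : exists2 g : set_type (wedge_spheres R n d) -> set_type X,
    continuous g & forall x, g (q x) = h (one, x).
  apply: (quotient_factor _ _ _ q (fun x => h (one, x))) => // x x' /qE[->//|[x0 x0']].
  by apply: val_inj; rewrite /= one1 !push1_flat.
pose Q (z : I01 * set_type X) := (z.1, q z.2).
have Qc : continuous Q.
  apply: continuous_pair; first exact: continuous_fst.
  exact: (continuous_o _ _ _ snd q (@continuous_snd _ _) qc).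
(* The product with the compact interval is again compact, so [Q] is a quotient map as well. *)
have [G Gc GQ] : exists2 G : I01 * set_type (wedge_spheres R n d) ->
    set_type (wedge_spheres R n d), continuous G & forall z, G (Q z) = q (h z).
  apply: (quotient_factor _ _ _ Q (fun z => q (h z))) => //.
  - by rewrite -setXTT; exact: compact_setX.
  - exact: prod_hausdorff.
  - by move=> [t w]; have [x <-] := qs w; exists (t, x).
  - exact: (continuous_o _ _ _ h q hc qc).
  move=> [t x] [t' x'] E; have <- : t = t' by exact: (congr1 fst E).
  have [->//|[x0 x0']] := qE x x' (congr1 snd E).
  apply: val_inj; apply/funext => -[i j].
  have B (y : set_type X) (y0 : forall i, m i (set_val y) = 0) :
      stereo (push (set_val t) (set_val y)) (i, j) = sphere_basept R d j.
    exact: (stereo_base i (push (set_val t) (set_val y)) (pX (t, y))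
      (push_flat_flat _ _ (I01P R t) (vX y) y0 i) j).
  exact: etrans (B x x0) (esym (B x' x0')).
have h0 t x : set_val t = 0 -> h (t, x) = x.
  by move=> t0; apply: val_inj; rewrite /= t0 push0.
have h1 t x : set_val t = 1 -> h (t, x) = h (one, x).
  by move=> t1; apply: val_inj; rewrite /= t1 one1.
exists q, g; split => //.
- apply: homotopic_sym; exists h; split => //; split; first exact: h0.
  by move=> t x /h1 ->; rewrite /= gq.
- apply: homotopic_sym; exists G; split => //; split => t w.
    by move=> t0; have [x <-] := qs w; rewrite (GQ (t, x)) h0.
  by move=> t1; have [x <-] := qs w; rewrite (GQ (t, x)) h1 //= gq.
Qed.

End ConeAndFacets.

(** * Complexes given by their nonfaces *)

Section Nonfaces.
Local Open Scope nat_scope.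

Lemma positive_eqbP : Equality.axiom Pos.eqb.
Proof. by move=> p q; apply: (iffP idP) => /Pos.eqb_eq. Qed.

HB.instance Definition _ := hasDecEq.Build positive positive_eqbP.

(** A mask is a finite nonempty set of labels written in binary. A [positive] is never empty, as
    befits a nonface, and inclusion is decided bit by bit, which keeps the many tests of a
    certificate cheap. *)
Fixpoint has_bit (p : positive) (k : nat) : bool :=
  match p, k with
  | xH, 0 | xI _, 0 => true
  | xH, _.+1 | xO _, 0 => false
  | xI p', k'.+1 | xO p', k'.+1 => has_bit p' k'
  end.

Fixpoint submask (p q : positive) : bool :=
  match p, q with
  | xH, xO _ => false
  | xH, _ => true
  | xI p', xI q' => submask p' q'
  | xI _, _ => false
  | xO _, xH => false
  | xO p', xO q' | xO p', xI q' => submask p' q'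
  end.

Fixpoint mask_size (p : positive) : nat :=
  match p with xH => 1 | xO p' | xI p' => (mask_size p').+1 end.

Definition point_mask (k : nat) : positive := iter k xO xH.

Lemma has_bit_lor p q k : has_bit (Pos.lor p q) k = has_bit p k || has_bit q k.
Proof.
by elim: p q k => [p IH|p IH|] [q|q|] [|k] //=; rewrite ?IH ?orbT ?orbF.
Qed.

Lemma has_bit_point j k : has_bit (point_mask j) k = (k == j).
Proof. by elim: j k => [|j IH] [|k] //=; exact: IH. Qed.

Lemma has_bit_ex p : exists k, has_bit p k.
Proof.
elim: p => [p _|p [k pk]|]; [by exists 0 | by exists k.+1 | by exists 0].
Qed.

Lemma has_bit_lt p k : has_bit p k -> k < mask_size p.
Proof. by elim: p k => [p IH|p IH|] [|k] //=; exact: IH. Qed.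

Lemma submaskP p q :
  reflect (forall k, has_bit p k -> has_bit q k) (submask p q).
Proof.
apply: (iffP idP).
  elim: p q => [p IH|p IH|] [q|q|] //= pq [|k] //=; exact: IH.
elim: p q => [p IH|p IH|] [q|q|] //= pq.
- by apply: IH => k; exact: (pq k.+1).
- exact: (pq 0).
- by have [k pk] := has_bit_ex p; have := pq k.+1 pk; case: k {pk}.
- by apply: IH => k; exact: (pq k.+1).
- by apply: IH => k; exact: (pq k.+1).
- by have [k pk] := has_bit_ex p; have := pq k.+1 pk; case: k {pk}.
- exact: (pq 0).
Qed.

(* Written with [if], as call-by-value evaluation computes both sides of [||]. *)
Fixpoint covers (F : seq positive) (q : positive) : bool :=
  if F is f :: F' then if submask f q then true else covers F' q else false.

Lemma coversP F q : reflect (exists2 f, f \in F & submask f q) (covers F q).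
Proof.
elim: F => [|f F IH] /=; first by right; case.
case: ifP => fq; first by left; exists f; rewrite ?mem_head.
apply: (iffP IH) => -[g gF gq]; exists g => //; first by rewrite inE gF orbT.
by move: gF; rewrite inE => /orP[/eqP gf|//]; rewrite -gf gq in fq.
Qed.

(** * Removal of faces in terms of nonfaces *)

Section FaceComplex.
Variables (V : finType) (N : nat) (lab : V -> nat) (ed : nat -> V).
Hypotheses (labK : forall k, k < N -> lab (ed k) = k)
  (edK : forall w, lab w < N -> ed (lab w) = w).
Implicit Types (F : seq positive) (p q f g : positive) (s t : {set V}).

Definition face p : {set V} := [set w | has_bit p (lab w)].

(** Labels from [N] on belong to elements of [V] that are not vertices of the complex; the bound in
    the second clause excludes them. *)
Definition face_complex F : {set {set V}} :=
  [set s : {set V} | [&& s != finset.set0, s \subset [set w | lab w < N] &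
    all (fun f => ~~ (face f \subset s)) F]].

Lemma in_face p w : (w \in face p) = has_bit p (lab w).
Proof. by rewrite inE. Qed.

Lemma face_complexP F s :
  reflect [/\ s != finset.set0, forall w, w \in s -> lab w < N &
    forall f, f \in F -> ~ face f \subset s] (s \in face_complex F).
Proof.
rewrite inE; apply: (iffP and3P) => -[s0 sN sF]; split => //.
- by move=> w /(fintype.subsetP sN); rewrite inE.
- by move=> f fF; apply/negP/(allP sF).
- by apply/fintype.subsetP => w /sN; rewrite inE.
- by apply/allP => f fF; apply/negP/sF.
Qed.

Lemma face_complex_is_complex F : is_simplicial_complex V (face_complex F).
Proof.
apply/andP; split; first by apply/negP => /face_complexP[]; rewrite eqxx.
apply/forall_inP => s /face_complexP[_ sN sF]; apply/forallP => t.
apply/implyP => /andP[t0 ts]; apply/face_complexP; split => //.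
- by move=> w /(fintype.subsetP ts)/sN.
- by move=> f fF ft; apply: (sF f fF); exact: fintype.subset_trans ft ts.
Qed.

Lemma face_lor_subset p q s :
  face p \subset s -> face q \subset s -> face (Pos.lor p q) \subset s.
Proof.
move=> /fintype.subsetP ps /fintype.subsetP qs; apply/fintype.subsetP => w.
by rewrite in_face has_bit_lor => /orP[?|?]; [apply: ps|apply: qs]; rewrite in_face.
Qed.

Lemma face_submask p q : submask p q -> face p \subset face q.
Proof.
by move/submaskP => pq; apply/fintype.subsetP => w; rewrite !in_face; exact: pq.
Qed.

(** Domination read off from nonfaces. Adding [k] to a simplex that contains [p] can only complete a
    nonface [f] with [k] in it; a nonface inside the union of [p] and [f] that avoids [k] would then
    already lie in the simplex. *)
Definition removable F p k : bool :=
  let G := [seq g <- F | ~~ has_bit g k] in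
  [&& k < N, has (has_bit p) (iota 0 N), ~~ has_bit p k &
    all (fun f => if has_bit f k then covers G (Pos.lor p f) else true) F].

(** Once [p] is a nonface, the masks containing it are redundant; dropping them keeps the list
    short. *)
Fixpoint collapse_seq F (steps : seq (positive * nat)) : option (seq positive) :=
  if steps is (p, k) :: steps' then
    if removable F p k then
      collapse_seq (p :: [seq f <- F | ~~ submask p f]) steps'
    else None
  else Some F.

Lemma removable_dominated F p k s : removable F p k ->
  s \in face_complex F -> face p \subset s -> (ed k |: s)%SET \in face_complex F.
Proof.
move=> /and4P[kN _ pk /allP FG] /face_complexP[s0 sN sF] ps.
apply/face_complexP; split.
- by apply/finset.set0Pn; exists (ed k); rewrite finset.setU11.
- by move=> w; rewrite finset.in_setU1 => /orP[/eqP ->|/sN //]; rewrite labK.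
move=> f fF fs; have := FG f fF; case: ifPn => [fk|fk _]; last first.
  apply: (sF f fF); apply/fintype.subsetP => w wf.
  have := fintype.subsetP fs w wf; rewrite finset.in_setU1 => /orP[/eqP wk|//].
  by move: wf; rewrite in_face wk labK // (negbTE fk).
case/coversP => g; rewrite mem_filter => /andP[gk gF] gpf.
apply: (sF g gF); apply/fintype.subsetP => w wg.
have pfs : face (Pos.lor p f) \subset (ed k |: s)%SET.
  by apply: face_lor_subset => //; exact: fintype.subset_trans ps (finset.subsetUr _ _).
have := fintype.subsetP pfs w (fintype.subsetP (face_submask g _ gpf) w wg).
rewrite finset.in_setU1 => /orP[/eqP wk|//].
by move: wg; rewrite in_face wk labK // (negbTE gk).
Qed.

Lemma face_complex_cons F p :
  face_complex (p :: [seq f <- F | ~~ submask p f]) =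
  [set s in face_complex F | ~~ (face p \subset s)]%SET.
Proof.
apply/setP => s; apply/face_complexP/setIdP => [[s0 sN sF]|[/face_complexP[s0 sN sF] ps]].
  have ps : ~ face p \subset s by apply: sF; rewrite mem_head.
  split; last exact/negP.
  apply/face_complexP; split => // f fF.
  have [pf|pf] := boolP (submask p f).
    by move=> fs; apply: ps; exact: fintype.subset_trans (face_submask _ _ pf) fs.
  by apply: sF; rewrite inE mem_filter pf fF orbT.
split => // f; rewrite inE mem_filter => /orP[/eqP ->|/andP[_ fF]]; first exact/negP.
exact: sF.
Qed.

Lemma collapse_seq_homotopy_equivalent (R : realType) F steps F' :
  collapse_seq F steps = Some F' ->
  homotopy_equivalent R (set_type (realization R V (face_complex F)))
    (set_type (realization R V (face_complex F'))).
Proof.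
elim: steps F => [|[p k] steps IH] F /=.
  by move=> [<-]; exact: homotopy_equivalent_refl.
case: ifP => // Fpk /IH; apply: homotopy_equivalent_trans.
rewrite face_complex_cons; have /and4P[kN /hasP[j jN pj] pk _] := Fpk.
rewrite mem_iota add0n /= in jN.
have p0 : face p != finset.set0.
  by apply/finset.set0Pn; exists (ed j); rewrite in_face labK.
have kp : ed k \notin face p by rewrite in_face labK.
exact: (collapse_homotopy_equivalent R V _ _ _ (face_complex_is_complex F) p0 kp
  (fun t => removable_dominated F p k t Fpk)).
Qed.

Lemma face_complex_sub F G : all (covers F) G -> face_complex F \subset face_complex G.
Proof.
move=> /allP FG; apply/fintype.subsetP => s /face_complexP[s0 sN sF].
apply/face_complexP; split => // g /FG/coversP[f fF fg] gs.
by apply: (sF f fF); exact: fintype.subset_trans (face_submask _ _ fg) gs.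
Qed.

(** * Certificates for wedges of spheres *)

Definition mask_bits p : seq nat := [seq k <- iota 0 N | has_bit p k].

(* [F] with a cone of apex [k] over the subcomplex obtained by deleting the faces
   [crit]: the only new nonfaces are the joins of [k] with these faces. *)
Definition cone_over (k : nat) F (crit : seq positive) : seq positive :=
  [seq f <- F | ~~ has_bit f k] ++ [seq Pos.lor p (point_mask k) | p <- crit].

(** The decidable form of the hypotheses on a cone with facets attached. That [p] is not covered
    makes it a simplex; that adding any further label, including the apex [k], gives a covered mask
    makes it maximal; the pairwise clause makes the facets distinct. *)
Definition critical_facets (d k : nat) F (crit : seq positive) : bool :=
  let G := cone_over k F crit in
  [&& k < N,
    all (fun f => mask_size f <= N) G,
    all (fun f => ~~ submask f (point_mask k)) G,
    all (fun p => [&& mask_size p <= N, ~~ has_bit p k, size (mask_bits p) == d.+1,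
      ~~ covers G p &
      all (fun j => if has_bit p j then true else covers G (Pos.lor p (point_mask j)))
        (iota 0 N)]) crit &
    pairwise (fun p q => ~~ submask p q) crit].

(** The bound matters: a bit of [p] from [N] on may name no element of [V] and would be invisible in
    [face p]. *)
Lemma face_subset_submask p q : mask_size p <= N ->
  face p \subset face q -> submask p q.
Proof.
move=> pN /fintype.subsetP pq; apply/submaskP => k pk.
have kN : k < N by exact: leq_trans (has_bit_lt _ _ pk) pN.
by have := pq (ed k); rewrite !in_face labK //; exact.
Qed.

Lemma face_point k : k < N -> face (point_mask k) = [set ed k]%SET.
Proof.
move=> kN; apply/setP => w; rewrite in_face has_bit_point finset.in_set1.
apply/eqP/eqP => [wk|->]; last exact: labK.
by rewrite -wk edK // wk.
Qed.

Lemma critical_facets_homotopy_equivalent (R : realType) d k F crit n :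
  size crit = n -> critical_facets d k F crit ->
  homotopy_equivalent R (set_type (realization R V (face_complex (cone_over k F crit))))
    (set_type (wedge_spheres R n d)).
Proof.
move=> <- {n}; set G := cone_over k F crit.
case/and5P=> kN /allP GN /allP Gk /allP critP crit_pw.
pose mask (i : 'I_(size crit)) := nth xH crit i.
have maskP i : mask i \in crit by exact: mem_nth.
pose u i (j : 'I_d.+1) := ed (nth 0 (mask_bits (mask i)) j).
have bitsP i j : j < d.+1 -> has_bit (mask i) (nth 0 (mask_bits (mask i)) j) /\
    nth 0 (mask_bits (mask i)) j < N.
  move=> jd; have /and5P[_ _ /eqP sz _ _] := critP _ (maskP i).
  have : nth 0 (mask_bits (mask i)) j \in mask_bits (mask i) by rewrite mem_nth ?sz.
  by rewrite mem_filter mem_iota add0n => /andP[].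
have facetE i : facet V (size crit) d u i = face (mask i).
  have /and5P[pN _ /eqP sz _ _] := critP _ (maskP i).
  apply/setP => w; apply/imsetP/idP => [[j _ ->]|].
    by have [? ?] := bitsP i j (ltn_ord j); rewrite in_face labK.
  rewrite in_face => wi.
  have wN : lab w < N by exact: leq_trans (has_bit_lt _ _ wi) pN.
  have wb : lab w \in mask_bits (mask i) by rewrite mem_filter wi mem_iota.
  have jd : index (lab w) (mask_bits (mask i)) < d.+1 by rewrite -sz index_mem.
  by exists (Ordinal jd) => //; rewrite /u /= nth_index // edK.
have mask_cone i : Pos.lor (mask i) (point_mask k) \in G.
  by rewrite mem_cat; apply/orP; right; exact: (map_f (fun p => Pos.lor p (point_mask k))).
have maskk i : ~~ has_bit (mask i) k by have /and5P[] := critP _ (maskP i).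
apply: (wedge_homotopy_equivalent R V (size crit) d (face_complex G) (ed k) u).
- exact: face_complex_is_complex.
- move=> i j j' /(congr1 lab); rewrite /u.
  rewrite (labK _ (bitsP i j (ltn_ord j)).2) (labK _ (bitsP i j' (ltn_ord j')).2).
  have /and5P[_ _ /eqP sz _ _] := critP _ (maskP i) => /eqP.
  rewrite nth_uniq ?sz ?filter_uniq ?iota_uniq // => /eqP; exact: val_inj.
- move=> i; rewrite facetE; have /and5P[pN _ /eqP sz pG _] := critP _ (maskP i).
  apply/face_complexP; split.
  + have [? ?] := bitsP i 0 isT.
    by apply/finset.set0Pn; exists (ed (nth 0 (mask_bits (mask i)) 0)); rewrite in_face labK.
  + by move=> w; rewrite in_face => /has_bit_lt /leq_trans; apply.
  + move=> f fG /(face_subset_submask _ _ (GN f fG)) fp.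
    by case/coversP: pG; exists f.
- move=> i i'; rewrite !facetE => E.
  have sub j j' : face (mask j) = face (mask j') -> submask (mask j) (mask j').
    have /and5P[pN _ _ _ _] := critP _ (maskP j).
    by move=> Ej; apply: face_subset_submask => //; rewrite Ej.
  have pw : forall a b, a < b -> b < size crit -> ~~ submask (nth xH crit a) (nth xH crit b).
    by move=> a b ab b1; apply: (pairwiseP xH crit_pw) => //; exact: ltn_trans ab b1.
  apply: val_inj; case: (ltngtP i i') => // ii'.
    by have := pw _ _ ii' (ltn_ord i'); rewrite sub.
  by have := pw _ _ ii' (ltn_ord i); rewrite sub.
- move=> i s sG; rewrite facetE => ps.
  have /and5P[pN _ _ _ /allP pmax] := critP _ (maskP i).
  apply/eqP; rewrite finset.eqEsubset ps andbT; apply/fintype.subsetP => w ws.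
  have /face_complexP[_ sN sF] := sG; have wN := sN w ws.
  have := pmax (lab w); rewrite mem_iota add0n => /(_ wN).
  rewrite in_face; case: ifP => // _ /coversP[g gG gpw]; exfalso; apply: (sF g gG).
  apply: fintype.subset_trans (face_submask _ _ gpw) _.
  by apply: face_lor_subset => //; rewrite face_point // edK // finset.sub1set.
(* A nonface inside [ed k |: s] either avoids [k] and then lies in [s] already, or is a critical [p]
   joined with [k], and then [s] contains the facet of [p]. *)
- move=> s /face_complexP[s0 sN sF] sP; apply/face_complexP; split.
  + by apply/finset.set0Pn; exists (ed k); rewrite finset.setU11.
  + by move=> w; rewrite finset.in_setU1 => /orP[/eqP ->|/sN //]; rewrite labK.
  move=> f fG fs.
  have drop (q : positive) : ~~ has_bit q k -> face q \subset (ed k |: s)%SET ->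
      face q \subset s.
    move=> qk /fintype.subsetP qs; apply/fintype.subsetP => w wq.
    have := qs w wq; rewrite finset.in_setU1 => /orP[/eqP wk|//].
    by move: wq; rewrite in_face wk labK // (negbTE qk).
  have := fG; rewrite mem_cat mem_filter => /orP[/andP[fk _]|/mapP[p pc fE]].
    exact: (sF f fG (drop f fk fs)).
  have /(nthP xH)[i ic ip] := pc.
  have := sP (Ordinal ic); rewrite facetE /mask /= ip => /negP; apply.
  have /and5P[_ pk _ _ _] := critP _ pc.
  apply: drop pk (fintype.subset_trans _ fs).
  by apply: face_submask; rewrite fE; apply/submaskP => j pj; rewrite has_bit_lor pj.
- apply/face_complexP; split.
  + by apply/finset.set0Pn; exists (ed k); rewrite finset.set11.
  + by move=> w; rewrite finset.in_set1 => /eqP ->; rewrite labK.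
  + move=> f fG; rewrite -face_point // => /(face_subset_submask _ _ (GN f fG)).
    exact/negP/Gk.
- by move=> i; rewrite facetE in_face labK.
Qed.

(** The second collapse has to return to the complex of [L], but its list of nonfaces may differ in
    order or redundancy; hence the comparison by mutual covering. *)
Definition wedge_certificate (d k : nat) F (steps : seq (positive * nat))
    (crit : seq positive) (steps' : seq (positive * nat)) : bool :=
  if collapse_seq F steps is Some L then
    if critical_facets d k L crit then
      if collapse_seq (cone_over k L crit) steps' is Some L' then
        all (covers L) L' && all (covers L') L
      else false
    else false
  else false.

Lemma wedge_certificate_homotopy_equivalent (R : realType) d k F steps crit steps' n :
  size crit = n -> wedge_certificate d k F steps crit steps' ->
  homotopy_equivalent R (set_type (realization R V (face_complex F)))
    (set_type (wedge_spheres R n d)).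
Proof.
rewrite /wedge_certificate => cn; case E: collapse_seq => [L|//].
case: ifP => // /(critical_facets_homotopy_equivalent R d k L crit n cn) W.
case E': collapse_seq => [L'|//] /andP[LL' L'L].
have LE : face_complex L = face_complex L'.
  by apply/eqP; rewrite finset.eqEsubset !face_complex_sub.
apply: homotopy_equivalent_trans (collapse_seq_homotopy_equivalent R _ _ _ E) _.
rewrite LE; apply: homotopy_equivalent_trans W.
exact/homotopy_equivalent_sym/(collapse_seq_homotopy_equivalent R _ _ _ E').
Qed.

End FaceComplex.

End Nonfaces.

(** * Matchings on the Hasse diagram *)

Section HasseLabels.
Local Open Scope nat_scope.

Definition nbit (a k : nat) : bool := odd (a %/ 2 ^ k).

Definition code (s : {set 'I_4}) : nat :=
  (@Ordinal 4 0 isT \in s) + (@Ordinal 4 1 isT \in s) * 2 +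
  (@Ordinal 4 2 isT \in s) * 4 + (@Ordinal 4 3 isT \in s) * 8.

Definition decode (a : nat) : {set 'I_4} := [set i : 'I_4 | nbit a i].

Lemma nbit_code s (i : 'I_4) : nbit (code s) i = (i \in s).
Proof.
rewrite /code; case: i => -[|[|[|[|//]]]] h; rewrite (bool_irrelevance h isT).
all: by do 4 case: (_ \in s).
Qed.

Lemma codeK : cancel code decode.
Proof. by move=> s; apply/setP => i; rewrite inE nbit_code. Qed.

Lemma code_lt s : code s < 16.
Proof. by rewrite /code; do 4 case: (_ \in s). Qed.

Lemma decodeK a : a < 16 -> code (decode a) = a.
Proof. by rewrite /code !inE; do 16 (case: a => [//|a]). Qed.

Definition covering (a b : nat) : bool :=
  all (fun k => nbit a k ==> nbit b k) (iota 0 4) &&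
  (count (nbit b) (iota 0 4) == (count (nbit a) (iota 0 4)).+1).

Lemma all_code (P : nat -> bool) : all P (iota 0 4) = [forall i : 'I_4, P i].
Proof.
apply/allP/forallP => [H i|H k]; first by apply: H; rewrite mem_iota /=.
by rewrite mem_iota add0n => /andP[_ k4]; exact: (H (Ordinal k4)).
Qed.

Lemma count_code s : count (nbit (code s)) (iota 0 4) = #|s|.
Proof.
rewrite -val_enum_ord count_map -sum1_card -sum1_count big_enum_cond /=.
by apply: eq_bigl => i; rewrite nbit_code.
Qed.

Lemma covering_code s t :
  covering (code s) (code t) = (s \proper t) && (#|t| == #|s|.+1).
Proof.
rewrite /covering !count_code all_code finset.properEcard.
have -> : [forall i : 'I_4, nbit (code s) i ==> nbit (code t) i] = (s \subset t).
  apply/forallP/fintype.subsetP => H i; have := H i; rewrite !nbit_code; first exact/implyP.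
  by move/implyP.
by case: eqP => [->|]; rewrite ?andbF // ltnS leqnn !andbT.
Qed.

Definition complex3 (b : bool) := if b then Delta3 else bdDelta3.

(** The code 15 is the whole vertex set, the one simplex that the boundary lacks. *)
Definition code_vertex (b : bool) (a : nat) : bool := (a != 0) && (b || (a != 15)).

Lemma code_vertexE b s : code_vertex b (code s) = (s \in complex3 b).
Proof.
have cE a t : a < 16 -> decode a = t -> (code s == a) = (s == t).
  move=> a16 <-; apply/eqP/eqP => [<-|->]; first by rewrite codeK.
  exact: decodeK.
have d0 : decode 0 = finset.set0.
  by apply/setP => i; rewrite !inE /nbit div0n.
have d15 : decode 15 = [set: 'I_4]%SET.
  by apply/setP => i; rewrite !inE; case: i => -[|[|[|[|//]]]].
rewrite /code_vertex (cE 0 _ isT d0) (cE 15 _ isT d15).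
by case: b; rewrite inE ?andbT.
Qed.

Definition hasse_codes (b : bool) : seq (nat * nat) :=
  [seq e <- [seq (a, a') | a <- iota 0 16, a' <- iota 0 16] |
    [&& code_vertex b e.1, code_vertex b e.2 & covering e.1 e.2]].

(* The pair of empty sets is not an edge of the Hasse diagram; it serves as the
   apex of the auxiliary cone. *)
Definition labels (b : bool) : seq (nat * nat) := rcons (hasse_codes b) (0, 0).

Definition label (b : bool) (e : {set 'I_4} * {set 'I_4}) : nat :=
  index (code e.1, code e.2) (labels b).

Definition edge_of_label (b : bool) (k : nat) : {set 'I_4} * {set 'I_4} :=
  let e := nth (0, 0) (labels b) k in (decode e.1, decode e.2).

Lemma hasse_codesP b e :
  ((code e.1, code e.2) \in hasse_codes b) = hasse_edge _ (complex3 b) e.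
Proof.
have eI : (code e.1, code e.2) \in [seq (a, a') | a <- iota 0 16, a' <- iota 0 16].
  by apply/allpairsP; exists (code e.1, code e.2); split; rewrite ?mem_iota ?code_lt.
by rewrite mem_filter eI andbT /= !code_vertexE covering_code.
Qed.

Lemma label_edge b k : k < size (labels b) -> label b (edge_of_label b k) = k.
Proof.
move=> kN; have : nth (0, 0) (labels b) k \in labels b by exact: mem_nth.
have /allP/[apply] : all (fun e => (e.1 < 16) && (e.2 < 16)) (labels b) by case: b {kN}.
case/andP=> e1 e2; rewrite /label /= !decodeK // -surjective_pairing index_uniq //.
by case: b {kN e1 e2}.
Qed.

Lemma edge_label b e : label b e < size (labels b) -> edge_of_label b (label b e) = e.
Proof.
rewrite index_mem => eb; rewrite /edge_of_label nth_index //= !codeK.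
by case: e {eb}.
Qed.

Definition code_conflict (e f : nat * nat) : bool :=
  [|| e.1 == f.1, e.1 == f.2, e.2 == f.1 | e.2 == f.2].

(** The first mask declares the apex a nonface: its label is reserved from the start, but it becomes
    a vertex only in the auxiliary cone. *)
Definition conflict_masks (b : bool) : seq positive :=
  let n := size (hasse_codes b) in
  point_mask n ::
  [seq Pos.lor (point_mask ij.1) (point_mask ij.2) |
    ij <- [seq (i, j) | i <- iota 0 n, j <- iota 0 n] &
    (ij.1 < ij.2) &&
    code_conflict (nth (0, 0) (labels b) ij.1) (nth (0, 0) (labels b) ij.2)].

Lemma size_labels b : size (labels b) = (size (hasse_codes b)).+1.
Proof. by rewrite size_rcons. Qed.

Lemma label_hasse_edge b e :
  hasse_edge _ (complex3 b) e = (label b e < size (hasse_codes b)).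
Proof.
rewrite -hasse_codesP /label /labels -cats1 index_cat.
by case: ifP => eb; rewrite ?index_mem // ltnNge leq_addr.
Qed.

Opaque hasse_codes labels.

(** A set of edges fails to be a matching exactly when two of its members share a simplex, so
    conflicting pairs suffice as nonfaces among the edges. *)
Lemma GM_face_complex b : GM _ (complex3 b) =
  face_complex _ (size (labels b)) (label b) (conflict_masks b).
Proof.
set n := size (hasse_codes b).
have sN : size (labels b) = n.+1 by exact: size_labels.
have labE e : hasse_edge _ (complex3 b) e = (label b e < n).
  exact: label_hasse_edge.
rewrite /conflict_masks -/n; clearbody n.
have nthE e : label b e < n.+1 ->
    nth (0, 0) (labels b) (label b e) = (code e.1, code e.2).
  by rewrite -sN index_mem; exact: nth_index.
have confE e f : code_conflict (code e.1, code e.2) (code f.1, code f.2) =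
    ~~ [&& e.1 != f.1, e.1 != f.2, e.2 != f.1 & e.2 != f.2].
  by rewrite /code_conflict /= !(can_eq codeK) !negb_and !negbK.
have lab_inj e f : label b e < n.+1 -> label b e = label b f -> e = f.
  by move=> eN ef; rewrite -(edge_label b e) ?sN // ef edge_label // sN -ef.
apply/setP => M; rewrite inE; apply/idP/face_complexP.
  case/andP=> M0 /andP[/forall_inP Me /forall_inP Mm]; split => //.
    by move=> e /Me; rewrite labE sN => /leqW.
  move=> f; rewrite inE => /orP[/eqP ->|].
    have nN : n < size (labels b) by rewrite sN.
    rewrite (face_point _ _ _ _ (label_edge b) (edge_label b)) // finset.sub1set.
    by move/Me; rewrite labE label_edge // ltnn.
  case/mapP => -[i j]; rewrite mem_filter => /andP[/= /andP[ij cij]].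
  case/allpairsP => -[i' j'] /= [+ + [? ?]]; subst i' j'.
  rewrite !mem_iota !add0n /= => iN jN -> /fintype.subsetP fM.
  have inM k : k < n -> (k == i) || (k == j) -> edge_of_label b k \in M.
    move=> kN kij; apply: fM; rewrite in_face has_bit_lor !has_bit_point.
    by rewrite (label_edge b k) ?kij ?sN ?leqW.
  have iM := inM i iN (introT orP (or_introl (eqxx i))).
  have jM := inM j jN (introT orP (or_intror (eqxx j))).
  have iL := label_edge b i; have jL := label_edge b j.
  rewrite sN in iL jL.
  have iL' := iL (leqW iN); have jL' := jL (leqW jN).
  have := nthE (edge_of_label b i); rewrite iL' => /(_ (leqW iN)) ci.
  have := nthE (edge_of_label b j); rewrite jL' => /(_ (leqW jN)) cj.
  move: cij; rewrite ci cj confE => /negP; apply.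
  have := forall_inP (Mm _ iM) _ jM; move/implyP; apply.
  by apply: contraTneq ij => E; rewrite -iL' -jL' E ltnn.
case=> M0 MN MF; rewrite M0 /=.
have Me e : e \in M -> label b e < n.
  move=> eM; have := MN e eM; rewrite sN ltnS leq_eqVlt => /orP[/eqP en|//].
  case: (MF (point_mask n)); first by rewrite inE eqxx.
  have nN : n < size (labels b) by rewrite sN.
  rewrite (face_point _ _ _ _ (label_edge b) (edge_label b)) // finset.sub1set -en.
  by rewrite edge_label // sN en.
apply/andP; split; first by apply/forall_inP => e /Me; rewrite labE.
apply/forall_inP => e eM; apply/forall_inP => f fM; apply/implyP => ef.
apply: contraT; rewrite -confE => cef.
have nef : label b e != label b f.
  by apply: contra ef => /eqP /lab_inj -> //; exact/leqW/Me.
(* Conflict is symmetric, whereas the masks are listed for increasing labels only. *)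
wlog lt_ef : e f eM fM cef ef nef / label b e < label b f.
  move=> W; case: (ltngtP (label b e) (label b f)) => [lt|lt|E].
  - exact: (W e f).
  - apply: (W f e) => //; [|by rewrite eq_sym|by rewrite eq_sym].
    by move: cef; rewrite /code_conflict /= (eq_sym (code f.1)) (eq_sym (code f.1) (code e.2))
      (eq_sym (code f.2)) (eq_sym (code f.2) (code e.2)) orbCA; case: eqP; case: eqP; case: eqP.
  - by rewrite E eqxx in nef.
exfalso; apply: (MF (Pos.lor (point_mask (label b e)) (point_mask (label b f)))).
  rewrite inE; apply/orP; right; apply/mapP.
  exists (label b e, label b f) => //.
  rewrite mem_filter /= lt_ef (nthE e (leqW (Me e eM))) (nthE f (leqW (Me f fM))) cef /=.
  apply/allpairsP; exists (label b e, label b f).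
  by split; rewrite ?mem_iota ?add0n ?Me.
apply: (face_lor_subset); rewrite (face_point _ _ _ _ (label_edge b) (edge_label b)) ?sN;
  try exact/leqW/Me; rewrite finset.sub1set edge_label // sN; exact/leqW/Me.
Qed.


Transparent hasse_codes labels.

(* Found by a randomised greedy computer search.  For the boundary ([bd]) and for
   the full simplex: the collapses of GM(K) to L, the 39 facets, and the collapses
   of L' to L with the apex of the cone left out of the masks.  Bit [k] of a mask
   stands for the [k]-th pair of [labels]. *)
Definition bd_masks : seq positive :=
  [:: 53248; 2621696; 262162; 86016; 8421384; 1048594; 8228; 131202; 69760; 2084; 8650760; 3104;
  8390664; 8650768; 2130176; 393232; 264208; 33032; 262416; 8392712; 266256; 49408; 8390688;
  4202500; 34848; 8388872; 526368; 49216; 1060; 2081; 8652800; 131090; 49160; 1179650; 8912904;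
  9963520; 8914944; 263264; 271361; 1183808; 2102280; 135248; 1712128; 8913536; 8456320; 393736;
  33057; 33025; 5244929; 66690; 5251074; 1069120; 20513; 1187848; 4211072; 4260353; 66704; 1168;
  1042; 1069060; 1053760; 1052736; 2621960; 6291474; 41344; 1196096; 147520; 131138; 135232;
  8913056; 8913024; 4194593; 2130434; 4276225; 16708; 33104; 9474048; 327944; 151680; 33410;
  1179912; 397824; 2359560; 1181697; 4194640; 1057796; 1179968; 133633; 69712; 524704; 2236418;
  2359553; 8913410; 4268033; 4235392; 8458304; 16673; 289; 264712; 2101260; 2098306; 1154; 2098244;
  49282; 2109444; 4229128; 1057794; 8423425; 2494464; 527376; 8454528; 2228608; 70145; 41985;
  4196872; 33290; 33282; 6291969; 37408; 2129930; 8389156; 1067009; 133264; 1704192; 4261896; 68736;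
  1182208; 1573136; 8654912; 2367490; 83969; 4261892; 8650818; 2097552; 37896; 135312; 278848;
  135808; 66626; 66562; 8429696; 8650785; 335873; 336896; 2228864; 2228488; 1085456; 525408; 68616;
  1573890; 5244936; 5243393; 344066; 35856; 327690; 37904; 2131984; 2097488; 65872; 1181704;
  1067016; 73985; 262722; 329736; 8912914; 1048912; 8433664; 262242; 45184; 133137; 262666; 16800;
  327746; 1065228; 2132608; 4260240; 2099348; 2099724; 8978689; 6293636; 1184264; 1581313; 397345;
  70668; 2629642; 4260108]%positive.

Definition bd_vertices : seq nat :=
  [:: 10; 17; 6; 10; 20; 6; 7; 19; 2; 7; 16; 14; 9; 16; 22; 21; 0; 20; 22; 2; 10; 22; 9; 8; 22; 13;
  17; 1; 12; 18; 0; 6; 20; 19; 1; 0; 16; 14; 12; 2; 13; 2; 8; 1; 2; 21; 13; 20; 15; 19; 3; 2; 18; 2;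
  2; 11; 11; 21; 6; 3; 4; 23; 17; 15; 5; 8; 5; 9; 9; 13; 16; 18; 22; 18; 22; 20; 0; 22; 5; 5; 14; 0;
  13; 19; 2; 3; 4; 21; 2; 17; 3; 13; 6; 18; 1; 9; 17; 13; 22; 17; 13; 5; 4; 22; 7; 9; 3; 20; 13; 0;
  2; 2; 18; 12; 2; 22; 6; 11; 23; 13; 12; 10; 21; 0; 14; 14; 3; 23; 5; 3; 10; 7; 9; 2; 13; 21; 22;
  2; 14; 3; 5; 12; 23; 3; 11; 2; 0; 1; 14; 14; 14; 15; 22; 0; 22; 21; 22; 17; 23; 14; 10; 19; 22;
  14; 16; 23; 0; 14; 10; 21; 21; 2; 22; 22; 22; 2; 22; 17; 4; 9; 2; 23; 13; 13; 10; 14].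

Definition bd_critical : seq positive :=
  [:: 4194978; 8454292; 591889; 4464897; 6324304; 4268416; 411680; 9472512; 2228500; 405536;
  6555656; 83012; 4473089; 1061896; 2753026; 590224; 4456800; 2753088; 8454786; 2101332; 9961552;
  2135104; 2102289; 135692; 8978945; 2624640; 8458257; 655968; 139652; 533664; 8454668; 8986625;
  4202912; 2110465; 9437268; 1704449; 8912994; 271394; 4456994]%positive.

Definition bd_cone_masks : seq positive :=
  [:: 8454288; 8388754; 8388626; 8421506; 591888; 526480; 2099344; 4268160; 4260224; 395296; 264224;
  2080; 395776; 8423936; 8423424; 8390784; 34960; 35456; 2228496; 2097424; 2097409; 4202753;
  5251073; 397344; 151584; 151556; 20492; 6293512; 4196360; 81988; 4456705; 4210945; 4194561;
  5242881; 4260112; 1097729; 2752514; 2621450; 65936; 524688; 65812; 131472; 131216; 524432; 524306;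
  2097170; 18; 4227152; 5242960; 2622016; 2752576; 2621504; 2097730; 2622466; 2621442; 525378;
  2097794; 2622080; 2228304; 2622480; 4194946; 4259970; 82050; 16514; 8389250; 642; 65666; 524418;
  8388738; 8454272; 8389252; 590464; 524928; 131712; 592000; 2097236; 4194388; 4194384; 262224;
  262160; 4259841; 4259856; 2192; 65680; 2101316; 9961488; 37952; 5216; 1120; 36960; 135688;
  2232328; 590337; 592384; 591880; 591872; 67592; 8978944; 590336; 2623616; 526464; 133248; 2621568;
  69649; 69648; 5137; 1053712; 1053700; 1053704; 5132; 1069064; 20488; 1069056; 20481; 151552;
  397312; 135176; 1065985; 655456; 655680; 655424; 131152; 336; 1179712; 8912976; 524368; 65616;
  65556; 66576; 525328; 525376; 67600; 8456192; 8390656; 66049; 67585; 68608; 67588; 67584; 66176;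
  4259968; 4474880; 66628; 66624; 69696; 8651265; 131348; 131344; 4472833; 4210689; 49153; 70660;
  344128; 33825; 13316; 1048849; 525472; 524448; 525440; 524416; 65664; 16768; 66564; 147584; 9220;
  131456; 131232; 2098188; 135204; 135200; 131620; 131108; 131140; 131136; 2228480; 2097220;
  2097472; 2359552; 4456768; 262464; 327744; 8650816; 16676; 2099212; 8651040; 8454664; 8389128;
  8388616; 66058; 9437698; 8462337; 73729; 74752; 5128; 70656; 66560; 69633; 327681; 8454145; 65537;
  65552; 8651008; 344064; 8650753; 524560; 327936; 262401; 8912912; 273; 4268288; 4260104; 8608;
  4202880; 4202624; 130; 8576; 41088; 2097536; 2097408; 9344; 8352; 8396928; 8320; 131200; 2105348;
  2097164; 139276; 139268; 131332; 1187840; 143360; 1179904; 1064961; 1048833; 257; 1065220;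
  2106369; 2629633; 2629632; 2236416; 139265; 2621448; 2622464; 1048660; 1048656; 84; 8388688; 80;
  5136; 33856; 2098240; 1088; 282624; 2101312; 2097216; 262720; 278592; 21504; 20480; 36928; 1044;
  1040; 5124; 5248; 16452; 1184; 1152; 16512; 16420; 262210; 262208; 49184; 49152; 1049602; 2180;
  2176; 33824; 33794; 2129922; 4212736; 2105346; 2098178; 2098180; 5259268; 37024; 36896; 1704448;
  1703937; 1179649; 1183744; 135168; 1180160; 2101252; 1179664; 131088; 1179648; 131076; 524304;
  2097156; 2097280; 2097168; 4112; 17; 2064; 16; 132; 36; 384; 128; 4160; 5244928; 1064964; 1028;
  4196356; 2052; 1065984; 1067008; 8425472; 8912930; 271392; 5152; 267264; 263200; 1056; 1026;
  17408; 18432; 16385; 263168; 2098176; 1024; 1050624; 34824; 2056; 526336; 133120; 131073; 2621440;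
  131584; 2228224; 524289; 2097154; 8913408; 524800; 1049090; 8912928; 532512; 524320; 131104;
  131072; 278528; 16416; 262400; 288; 33024; 5251072; 4202752; 262154; 522; 4456962; 262658; 514;
  262146; 34; 96; 8650752; 32; 32832; 327680; 266240; 262152; 8421376; 270336; 262144; 2048;
  2097152; 69632; 4096; 32770; 576; 4194305; 1; 32768; 512; 8388610; 8388608; 8192; 2; 1048576; 64;
  4194304; 4; 16384; 65536; 8; 256]%positive.

Definition bd_cone_vertices : seq nat :=
  [:: 1; 15; 6; 5; 7; 21; 22; 1; 2; 9; 22; 7; 21; 7; 4; 2; 22; 22; 0; 22; 13; 20; 15; 14; 2; 3; 10;
  2; 14; 22; 16; 20; 4; 15; 2; 10; 3; 10; 2; 17; 23; 2; 21; 1; 6; 15; 22; 20; 2; 1; 4; 10; 22; 13;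
  7; 14; 22; 11; 2; 0; 16; 14; 19; 5; 5; 19; 13; 5; 13; 2; 12; 11; 17; 2; 14; 22; 16; 18; 10; 0; 11;
  7; 2; 2; 9; 0; 5; 14; 1; 23; 21; 13; 11; 3; 14; 10; 2; 6; 1; 17; 14; 2; 13; 10; 2; 20; 2; 3; 14;
  13; 17; 18; 0; 18; 18; 13; 2; 19; 8; 4; 20; 2; 23; 9; 16; 10; 2; 11; 0; 20; 14; 0; 9; 20; 18; 18;
  14; 7; 22; 2; 2; 0; 12; 18; 9; 12; 20; 0; 5; 15; 10; 13; 22; 12; 7; 23; 14; 17; 16; 8; 2; 2; 3; 2;
  21; 5; 12; 11; 9; 0; 6; 8; 21; 18; 13; 22; 22; 13; 16; 23; 9; 5; 22; 17; 13; 1; 20; 13; 22; 6; 12;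
  10; 3; 18; 18; 14; 18; 8; 4; 19; 19; 13; 22; 12; 23; 22; 17; 0; 23; 3; 14; 23; 21; 1; 15; 2; 10;
  2; 3; 12; 23; 12; 17; 21; 17; 9; 8; 20; 14; 0; 0; 0; 19; 23; 19; 22; 19; 17; 3; 18; 5; 11; 11; 10;
  15; 12; 12; 21; 2; 1; 18; 14; 5; 9; 22; 5; 22; 7; 5; 23; 11; 0; 21; 15; 22; 14; 11; 22; 22; 22; 5;
  1; 20; 3; 9; 22; 13; 13; 22; 20; 3; 3; 11; 3; 23; 0; 3; 4; 12; 2; 21; 3; 7; 11; 21; 14; 11; 0; 22;
  15; 0; 23; 15; 22; 8; 5; 6; 5; 9; 23; 9; 10; 11; 9; 3; 19; 19; 9; 13; 12; 0; 21; 14; 19; 3; 11;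
  17; 17; 21; 15; 20; 9; 21; 17; 21; 21; 9; 9; 1; 18; 23; 22; 6; 1; 22; 8; 17; 14; 18; 3; 22; 22;
  13; 15; 20; 3; 3; 22; 22; 16; 23; 6; 13; 15; 9; 12; 0; 20; 3; 21; 21; 20; 21; 11; 15; 15; 2; 20;
  3; 2; 15; 20; 3; 2; 19; 8; 3; 14; 8; 8; 14; 14; 16; 8; 19; 19; 19].

Definition full_masks : seq positive :=
  [:: 34080768; 151552; 8650754; 526368; 20608; 135296; 18882560; 1049664; 33556512; 18874370;
  266368; 8650768; 16785409; 33556488; 2105348; 86016; 82048; 2105346; 4195392; 526352; 18874369;
  16785412; 34078728; 278656; 34078736; 135266848; 35651594; 41943060; 134349120; 20971588;
  16941057; 34603018; 33558624; 20972096; 20971584; 4718656; 71827712; 25305088; 25174016; 16785440;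
  17309696; 16916480; 16785408; 20971530; 4722704; 8470529; 67190786; 528464; 528400; 18876928;
  2179074; 67192832; 3147792; 29360129; 4458504; 804864; 788480; 542720; 134744064; 527360; 526336;
  21495808; 4719104; 17301512; 4718848; 20971521; 20971522; 5243520; 67174976; 67127424; 4227456;
  35651904; 8470592; 16810497; 16809985; 1065344; 1065088; 16768; 18560; 16793728; 16512; 134481928;
  8470784; 4197504; 34603328; 34603072; 3145792; 33587236; 41945104; 41945088; 33622016; 33556484;
  33556608; 33556480; 34603648; 67241992; 3416064; 3162368; 134352912; 2146306; 2146308; 34078816;
  34078784; 34078976; 34111488; 34082816; 34078720; 1065248; 16859137; 71827464; 1048928; 3162114;
  2113538; 67125250; 33562636; 134488192; 151519234; 135266400; 100663329; 34603152; 8409152;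
  20971904; 67379204; 4272128; 134221841; 33628288; 17301521; 3146000; 136315968; 2130436;
  134230144; 4268160; 73856; 12416; 4198528; 4460608; 4198464; 36700162; 33697792; 143360; 16795680;
  16779296; 33562657; 20973576; 4228224; 4227329; 2130948; 561184; 18907152; 18874384; 18876416;
  18907136; 18890752; 18874368; 16795648; 83968; 8470528; 16793601; 16779272; 149504; 17301505;
  16793604; 16777249; 16777473; 16777217; 25165856; 25182208; 16793608; 150996992; 16844800;
  16779264; 16859136; 16793600; 133136; 81922; 16777226; 20971648; 16908296; 20971536; 20971520;
  81984; 25165840; 81952; 81920; 2113600; 16672; 16777250; 2098240; 8390672; 2097472; 25165826;
  17301506; 16777282; 16777218; 2113540; 2117632; 16777360; 16908416; 16777344; 2113792; 2146304;
  2113536; 16842768; 150994976; 16810000; 18433; 67127296; 18432; 264200; 3147776; 67125249;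
  67125280; 67126272; 67125248; 20544; 540680; 8652800; 544768; 528416; 20488; 20480; 16394; 16452;
  17472; 278530; 25296896; 49154; 8404994; 16644; 8405248; 147460; 8536064; 540673; 16385; 147464;
  16648; 528448; 8405056; 266304; 525376; 8651009; 33566724; 33562628; 33566720; 77824; 2109440;
  33558560; 33562625; 2367488; 33558656; 35659776; 36700160; 35651585; 4736; 4224; 69214208;
  2105344; 3146240; 34603016; 3145984; 3145736; 3145728; 2097409; 69206017; 2359552; 34603024;
  2130176; 35651840; 2129921; 2097665; 2129924; 2098177; 33558536; 35684352; 2130432; 33587204;
  33591296; 35651592; 35651600; 33554564; 33554444; 33554436; 33689600; 33558528; 35651584;
  33555072; 2101760; 135184; 135232; 135172; 8392720; 2101252; 8392768; 4160; 2098178; 2099201;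
  4198416; 2097220; 2097216; 2097666; 69207040; 2130944; 2098176; 33554952; 2361344; 2097664;
  41943048; 167936; 33562632; 33554449; 132160; 41943056; 264196; 134352896; 4612; 8392708; 8392736;
  33628160; 4640; 33554512; 33554448; 8458240; 69664; 41951232; 33562624; 1090; 4263936; 8400896;
  4198912; 134221856; 4198404; 33555008; 8396802; 73730; 100663328; 34603136; 4231168; 42008576;
  33554592; 41943041; 4722688; 34603010; 536576; 4718600; 33554465; 790528; 139266; 4726784;
  4718592; 34603009; 73760; 67182592; 525328; 524305; 67633168; 786433; 4268032; 786944; 67634177;
  262228; 8388900; 132226; 71303744; 151126272; 16777232; 151126016; 151519232; 135266880;
  135266368; 67371025; 67641345; 532481; 663552; 532736; 532480; 134225922; 8202; 8194; 67634176;
  270464; 67379200; 67117064; 67117060; 67174417; 5275904; 8356; 135268360; 1050632; 9439232;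
  1181696; 133248; 133128; 1051136; 1050656; 1050624; 4196480; 2688; 1049216; 66176; 672; 4259968;
  8390664; 4196360; 4227200; 4194944; 2180; 67712; 264704; 4194434; 4456576; 67616; 66688; 8456192;
  67764226; 8484; 8650785; 8397060; 1318944; 4489218; 4489472; 71368768; 4259904; 4194388; 71303232;
  4194370; 4194372; 4194368; 4194818; 4227074; 4259842; 262720; 1049152; 12582914; 5243392; 8520706;
  12845312; 524370; 67633218; 4196372; 134356993; 135266818; 1081864; 163860; 134218020; 8658945;
  67176449; 1056928; 1056800; 4228097; 1212544; 1179776; 1179728; 8519690; 67371076; 4456964;
  134230024; 8519937; 135405568; 134356992; 134349952; 13631504; 67895360; 786498; 1082496; 1081472;
  1310848; 1048706; 1048736; 4261904; 33620512; 13631744; 524866; 140296; 9437448; 8527873; 163857;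
  262417; 786512; 5275649; 71565316; 67110929; 525322; 66114; 262544; 4464644; 13632512; 1318913;
  71303188; 135397378; 655370; 12648464; 135004224; 295296; 134488072; 135266592; 12845060; 4227588;
  8519697; 295169; 135536640; 67601; 134349184; 1318920; 5137; 135397392; 1344000; 67371392;
  12591108; 67241092; 1082378; 131476; 8519956; 67240260; 164882; 134480161]%positive.

Definition full_vertices : seq nat :=
  [:: 26; 10; 20; 0; 15; 2; 27; 1; 9; 16; 2; 22; 8; 9; 3; 10; 5; 3; 4; 0; 16; 8; 17; 5; 17; 18; 9;
  17; 4; 23; 19; 17; 9; 1; 4; 18; 18; 3; 16; 27; 3; 27; 16; 9; 15; 5; 10; 27; 0; 3; 10; 10; 0; 16;
  9; 26; 9; 17; 17; 26; 9; 15; 18; 17; 18; 16; 16; 18; 1; 2; 4; 4; 5; 5; 8; 15; 10; 2; 2; 15; 10;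
  21; 24; 4; 23; 1; 18; 7; 0; 9; 26; 26; 17; 0; 1; 2; 8; 15; 10; 3; 3; 26; 17; 0; 9; 0; 26; 18; 5;
  1; 18; 3; 26; 19; 17; 5; 6; 18; 16; 15; 2; 4; 8; 10; 21; 5; 8; 0; 4; 3; 5; 26; 5; 2; 15; 2; 23;
  15; 23; 10; 23; 9; 23; 9; 4; 4; 12; 0; 8; 27; 3; 3; 8; 27; 23; 10; 1; 8; 9; 10; 27; 8; 16; 4; 11;
  6; 17; 15; 7; 22; 2; 5; 19; 10; 10; 9; 15; 2; 8; 3; 26; 6; 0; 21; 2; 18; 9; 4; 22; 4; 6; 17; 27;
  7; 3; 15; 8; 2; 5; 18; 20; 11; 8; 6; 8; 5; 2; 23; 9; 27; 19; 6; 17; 8; 5; 15; 9; 0; 27; 2; 5; 20;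
  23; 1; 5; 2; 10; 20; 3; 20; 10; 20; 15; 20; 15; 15; 27; 20; 2; 1; 13; 5; 8; 16; 10; 27; 9; 8; 8;
  15; 3; 15; 16; 5; 10; 16; 27; 18; 17; 18; 1; 4; 4; 11; 2; 17; 25; 26; 12; 27; 12; 16; 9; 16; 3;
  17; 0; 9; 6; 26; 17; 6; 23; 16; 1; 1; 27; 10; 2; 3; 10; 27; 5; 27; 16; 4; 15; 18; 1; 3; 11; 12;
  27; 1; 2; 3; 13; 19; 26; 8; 4; 6; 7; 19; 18; 13; 0; 5; 0; 26; 7; 22; 10; 20; 7; 16; 15; 22; 18;
  13; 3; 1; 10; 10; 16; 15; 19; 5; 16; 20; 13; 9; 27; 1; 15; 9; 10; 26; 4; 17; 0; 22; 17; 8; 6; 5;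
  23; 1; 13; 8; 18; 4; 18; 4; 6; 9; 6; 1; 4; 22; 8; 27; 3; 18; 1; 20; 22; 7; 1; 8; 8; 2; 7; 22; 18;
  27; 17; 23; 0; 27; 2; 2; 18; 27; 4; 26; 5; 1; 1; 18; 4; 22; 26; 18; 18; 10; 10; 0; 4; 8; 0; 1; 22;
  9; 18; 20; 3; 8; 20; 2; 4; 23; 8; 18; 20; 18; 20; 3; 10; 10; 5; 23; 20; 18; 20; 3; 27; 5; 26; 20;
  3; 1; 7; 18; 22; 22; 27; 0; 4; 4; 27; 23; 20; 8; 3; 2; 20; 3; 2; 4; 0; 5; 27; 1; 18; 27; 27; 27;
  10; 1; 13; 27; 23; 13; 10; 20; 20; 27; 4; 8; 10; 17; 5; 2; 3; 13; 8; 7; 10; 9; 0; 5; 5; 8; 18; 3;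
  3; 20; 20; 8; 10; 2; 22; 15; 0; 5; 2; 3; 4; 17; 26; 6; 4; 20; 13].

Definition full_critical : seq positive :=
  [:: 163986; 67109204; 151061056; 8658956; 9438226; 67174689; 67174945; 134488321; 1098784;
  134348882; 1229824; 67764488; 134349073; 67371156; 8454689; 4262401; 100794378; 41943392; 33188;
  134220833; 2195466; 4194708; 136316940; 164874; 17334560; 67174800; 67764544; 164484; 67111969;
  67240336; 1343776; 67240578; 819472; 67240980; 558114; 9438242; 134873601; 71368976;
  135267346]%positive.

Definition full_cone_masks : seq positive :=
  [:: 67109188; 150995520; 150995456; 150994944; 134283840; 8658948; 8396836; 8397856; 8396832;
  8389650; 8454162; 8454210; 67174433; 67174944; 67175425; 134480129; 1097760; 1098752; 1065992;
  1064968; 16392; 8404992; 16388; 49184; 311296; 278528; 16416; 16384; 524354; 1179712; 786496;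
  134348866; 134218306; 67764232; 67633416; 67633160; 67633154; 67895296; 134348817; 8454657;
  12648960; 4261889; 4261888; 67585; 68096; 2568; 100794376; 100663304; 33554440; 67240200;
  41943328; 41943296; 41943104; 41943040; 34603008; 33554528; 33554496; 33554464; 33184; 98464;
  2129930; 2129922; 2129920; 2101256; 4194452; 136316932; 136316928; 2099200; 67584; 2056; 2068;
  33802; 98314; 17334528; 17301760; 17301504; 16908288; 67174544; 67240256; 67764288; 67633216;
  67633152; 524384; 524608; 524352; 134348864; 134218304; 164480; 33408; 163970; 33718400; 33685632;
  33554560; 33554434; 33554432; 67174401; 67174528; 67174912; 4260352; 98432; 65664; 4227584;
  4227073; 164356; 67240449; 98818; 98306; 67242496; 67241984; 67174688; 99360; 67109216; 67109184;
  67371072; 3105; 67109921; 8390689; 8390688; 67117089; 67117088; 8352; 67109153; 67109152; 416;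
  262528; 67111937; 8389668; 8389728; 8389696; 8455184; 8454160; 8389153; 65872; 134283584;
  67371265; 134283552; 134218080; 131472; 33152; 163968; 163844; 164880; 1081632; 131714; 131202;
  642; 640; 134348928; 67371140; 67109028; 67371044; 67371524; 557328; 557072; 524304; 163856;
  134349072; 134348816; 134349060; 67240964; 67240968; 67239944; 67240448; 131648; 67240000; 131138;
  67109440; 578; 67109378; 67108932; 67108928; 1088; 67174432; 67108900; 8519682; 65616; 67109380;
  67109408; 67109376; 4194816; 67371009; 67108898; 67108896; 2080; 2176; 67110912; 264192; 2560;
  2048; 131090; 134283328; 67371136; 65602; 8388626; 134348804; 82; 66; 131588; 262224; 1048640;
  134217792; 67239938; 67108994; 134218244; 4456465; 67109900; 67109892; 71303172; 4194436; 4202500;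
  132108; 558082; 525314; 655362; 134348802; 525344; 132098; 8389666; 8389664; 8388642; 8388610;
  66592; 66050; 8388641; 8454176; 65600; 576; 8388640; 96; 16777280; 262208; 16777248; 16777216;
  516; 8650756; 8454656; 66056; 66048; 292; 8651008; 69640; 98336; 1318912; 65570; 65568; 1048864;
  98312; 8658944; 98560; 4292608; 33056; 4227328; 524576; 288; 786464; 786432; 524544; 524320;
  524290; 33025; 134218242; 164096; 33024; 262401; 134218272; 134349056; 4464896; 4464640; 270592;
  4206592; 4198400; 12845056; 8650752; 8389120; 8392704; 135168; 8519681; 12296; 4456449; 270344;
  13631488; 8520712; 9437192; 1179912; 134742529; 134742017; 524289; 524288; 134348800; 134218240;
  4608; 4104; 520; 262656; 512; 131074; 163840; 32780; 32776; 4227072; 4195332; 4194308; 132104;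
  1036; 12582928; 8389636; 8388620; 131080; 132100; 131216; 8388628; 64; 8388612; 8519680; 1179648;
  9437184; 131076; 131072; 67117056; 67108992; 67108865; 8388624; 4194432; 1048704; 384; 8320; 8452;
  8204; 4260112; 4259856; 71368704; 67109888; 71303168; 4456448; 67174400; 67109120; 67108864;
  262152; 12; 262400; 65538; 4194320; 4194306; 272; 2097156; 2097154; 2097160; 4259840; 8388608;
  4194304; 8; 256; 1056768; 73728; 1049618; 1048594; 1048578; 2; 128; 1048576; 294912; 262176; 32;
  4; 8192; 262144; 134217728; 32768; 16; 4096; 1024; 65536; 2097152]%positive.

Definition full_cone_vertices : seq nat :=
  [:: 5; 2; 3; 8; 5; 5; 10; 0; 8; 16; 6; 5; 10; 1; 22; 20; 18; 3; 23; 18; 2; 5; 15; 19; 8; 6; 1; 17;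
  27; 23; 8; 9; 5; 9; 18; 1; 5; 5; 10; 22; 3; 10; 26; 27; 3; 2; 8; 16; 15; 2; 20; 17; 1; 9; 15; 16;
  26; 15; 16; 1; 18; 4; 12; 27; 10; 4; 16; 26; 10; 2; 10; 16; 9; 17; 6; 9; 2; 1; 4; 9; 5; 0; 27; 4;
  27; 2; 2; 1; 18; 25; 8; 26; 16; 9; 0; 22; 5; 3; 15; 4; 27; 18; 4; 3; 11; 5; 10; 2; 10; 6; 0; 18;
  4; 1; 23; 13; 9; 2; 8; 7; 27; 18; 2; 18; 2; 22; 6; 16; 4; 0; 8; 20; 27; 5; 22; 0; 18; 15; 2; 10;
  3; 20; 0; 27; 4; 18; 2; 4; 5; 10; 9; 3; 17; 1; 27; 20; 2; 10; 3; 3; 1; 9; 6; 23; 4; 4; 5; 5; 18;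
  10; 16; 27; 10; 11; 20; 27; 22; 0; 22; 23; 11; 7; 11; 27; 4; 22; 0; 17; 10; 10; 5; 4; 5; 20; 3;
  18; 5; 23; 8; 23; 2; 10; 4; 18; 20; 22; 7; 8; 13; 3; 23; 17; 27; 9; 3; 0; 20; 16; 0; 9; 3; 27; 27;
  8; 6; 24; 2; 18; 2; 8; 2; 15; 3; 18; 8; 3; 12; 0; 18; 13; 10; 0; 22; 27; 0; 18; 22; 22; 4; 10; 19;
  2; 27; 13; 1; 3; 17; 9; 3; 20; 18; 3; 18; 22; 0; 20; 3; 12; 2; 10; 23; 20; 9; 17; 10; 19; 10; 2;
  20; 2; 13; 20; 13; 13; 12; 10; 15; 3; 20; 18; 18; 2; 1; 5; 15; 15; 20; 22; 20; 4; 23; 8; 20; 13;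
  0; 17; 17; 13; 7; 26; 6; 17; 17; 20; 0; 0; 8; 26; 22; 4; 4; 0; 20; 27; 27; 2; 3; 27; 0; 10; 3; 1;
  18; 20; 21; 2; 18; 27; 27; 4; 27; 20; 20; 27; 27; 27; 8; 23; 13; 20; 27; 27; 10; 27; 15; 18; 5; 7;
  2; 0; 12; 13; 10; 12; 27; 21; 16; 16; 16; 0; 0; 21; 0; 0].
Definition critical (b : bool) := if b then full_critical else bd_critical.

Definition steps (b : bool) : seq (positive * nat) :=
  if b then zip full_masks full_vertices else zip bd_masks bd_vertices.

(** Removing [p] joined with the apex [c] mirrors, inside the cone, the removal of [p] from A. The
    last step removes [c] itself, which by then is dominated by a vertex of what remains of A. *)
Definition cone_steps (b : bool) : seq (positive * nat) :=
  let c := point_mask (size (hasse_codes b)) in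
  let cone ms := rcons [seq Pos.lor p c | p <- ms] c in
  if b then zip (cone full_cone_masks) full_cone_vertices
  else zip (cone bd_cone_masks) bd_cone_vertices.

(** * Verification of the certificates *)

Lemma bd_certificate :
  wedge_certificate (size (labels false)) 4 (size (hasse_codes false))
    (conflict_masks false) (steps false) (critical false) (cone_steps false).
Proof. by vm_compute. Qed.

Lemma full_certificate :
  wedge_certificate (size (labels true)) 4 (size (hasse_codes true))
    (conflict_masks true) (steps true) (critical true) (cone_steps true).
Proof. by vm_compute. Qed.

End HasseLabels.

Lemma GM_wedge_spheres (R : realType) (b : bool) :
  homotopy_equivalent R (set_type (realization R _ (GM _ (complex3 b))))
    (set_type (wedge_spheres R 39 4)).
Proof.
rewrite GM_face_complex.
apply: (wedge_certificate_homotopy_equivalent _ _ _ _ (label_edge b) (edge_label b) R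
  4 (size (hasse_codes b)) _ (steps b) (critical b) (cone_steps b)).
  by case: b.
by case: b; [exact: full_certificate | exact: bd_certificate].
Qed.

Theorem mainTheorem14 (R : realType) :
  homotopy_equivalent R (set_type (realization R _ (GM _ Delta3)))
                        (set_type (realization R _ (GM _ bdDelta3))) /\
  homotopy_equivalent R (set_type (realization R _ (GM _ bdDelta3)))
                        (set_type (wedge_spheres R 39 4)).
Proof.
split; last exact: (GM_wedge_spheres R false).
(* The two complexes are compared through the wedge, each having its own certificate. *)
apply: homotopy_equivalent_trans (GM_wedge_spheres R true) _.
exact/homotopy_equivalent_sym/(GM_wedge_spheres R false).
Qed.
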